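(* Let $T>0$, $\alpha\in(\frac13,1)$, and let $\zeta\in\mathcal C^{\alpha}([0,T];\mathbb R^d)$ be a path with $\zeta_0=0$ admitting a Lévy area $\zeta^2$ as described in the context. Let $\mathcal K\subset\mathcal P_2(U)$ be compact and $\varepsilon,L>0$. Assume $b\in\mathcal C_b^{0,1,1}([0,T]\times\mathbb R^m\times U;\mathbb R^m)$ with $b(u,x,a)$ uniformly continuous in $u$, and $\sigma\in\mathcal C_b^{1,3}([0,T]\times\mathbb R^m;\mathbb R^{m,d})$. Let $F:[0,T]\times\mathbb R^m\times\mathcal K\to\mathbb R$ be bounded, Lipschitz continuous in $x$ uniformly over $\gamma\in\mathcal K$, and Lipschitz in $\gamma\in\mathcal K$ with respect to $W_2$, and let $G:\mathbb R^m\to\mathbb R$ be bounded, continuous and moreover Lipschitz. Let $V(s,y)$, $(s,y)\in[0,T]\times\mathbb R^m$, be the value function $$V(s,y)=\sup\Big\{\int_s^TF(r,x_r^{s,y,\gamma},\gamma_r)\,dr+G(x_T^{s,y,\gamma}):\ \gamma\in\mathcal V^{\varepsilon,L}([s,T])\Big\},$$ where $x^{s,y,\gamma}$ is the solution on $[s,T]$ of $x_t=y+\int_s^t\int_Ub(r,x_r,a)\gamma_r(da)dr+\int_s^t\sigma(r,x_r)d\zeta_r$. Then there is a constant $C_{\zeta,T}$ such that for all $(s_1,y_1),(s_2,y_2)\in[0,T]\times\mathbb R^m$, $$|V(s_2,y_2)-V(s_1,y_1)|\le C_{\zeta,T}\big\{|y_1-y_2|+(1+|y_1|+|y_2|)\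,|s_1-s_2|^\alpha\big\}.$$
   Context: Notation: $\delta f_{st}=f_t-f_s$ for paths, $\delta h_{sut}=h_{st}-h_{su}-h_{ut}$ for two-parameter functions. $\mathcal C_1^\mu(V)$: $\mu$-Hölder $V$-valued paths; $\mathcal C_2^\mu(V)$: continuous functions $h_{st}$, $s\le t$, vanishing for $s=t$, with $\sup|h_{st}|/|t-s|^\mu<\infty$. Repeated indices are summed. $\mathcal C_b^{k,l}$: functions $f(t,x)$ for which $\partial_t^i\partial_x^\beta f$ exist, are continuous and bounded for $i\le k$, $|\beta|\le l$. $b\in\mathcal C_b^{0,1,1}$: $b(t,x,a)$ is bounded and continuous, with bounded continuous first derivatives in $x$ and in $a$; in particular $a\mapsto b(t,x,a)$ is Lipschitz for the metric $d$ of $U$, uniformly in $(t,x)$. ''Uniformly continuous in $u$'' means: for each $x$, $\sup_{a\in U}|b(u_2,x,a)-b(u_1,x,a)|\to0$ as $|u_2-u_1|\to0$. The Lipschitz constants of $F$ are uniform in $t$, and $F$ is measurable in $t$ so that the time integrals make sense. The constant $C_{\zeta,T}$ may depend on $\zeta$, $T$ and the data $b,\sigma,F,G$, but not on $(s_i,y_i)$. Assumption on $\zeta$: $\zeta\in\mathcal C_1^\alpha(\mathbb R^d)$, $\zeta_0=0$, and there is $\zeta^2\in\mathcal C_2^{2\alpha}(\mathbb R^{d,d})$ with $\delta\zeta^{2;ij}_{sut}=\delta\zeta^i_{su}\,\delta\zeta^j_{ut}$ and $\zeta^{2;ij}_{st}+\zeta^{2;ji}_{st}=\delta\zeta^i_{st}\,\delta\zeta^j_{st}$.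 Solutions are in the rough path sense: for $\kappa\le\alpha$, $2\kappa+\alpha>1$, $\mathcal Q_\zeta^\kappa$ is the set of weakly controlled paths $z\in\mathcal C_1^\kappa$, $\delta z^i_{st}=z_s^{\zeta;ii_1}\delta\zeta^{i_1}_{st}+\rho^i_{st}$, $z^\zeta\in\mathcal C_1^\kappa$, $\rho\in\mathcal C_2^{2\kappa}$; and $\int_s^t\mu_u^i\,d\zeta_u^i=\lim\sum_q[\mu^i_{t_q}\delta\zeta^i_{t_qt_{q+1}}+\mu^{\zeta;ii_1}_{t_q}\zeta^{2;i_1i}_{t_qt_{q+1}}]$ over partitions of $[s,t]$ with mesh tending to $0$. The path $(\sigma^{ik}(s,x_s))_k$ is weakly controlled with derivative $\partial_{x_j}\sigma^{ik}(s,x_s)x_s^{\zeta;jl}$. For any $\kappa\in(1/3,\alpha)$ the equation has a unique solution in $\mathcal Q_\zeta^\kappa([s,T];\mathbb R^m)$. Control space: $U\subseteq\mathbb R^k$ is equipped with a metric $d$; $\mathcal P_2(U)$ is the set of Borel probability measures on $U$ with finite second moments, with the Wasserstein-2 metric $W_2(m_1,m_2)=\inf_{m\in\Gamma(m_1,m_2)}(\int\int d^2(x,y)\,dm(x,y))^{1/2}$, $\Gamma(m_1,m_2)$ being the set of couplings. $\mathcal V^{\varepsilon,L}([s,T])=\{\gamma:[s,T]\to\mathcal K:\ W_2(\gamma_r,\gamma_t)\le L|t-r|^\varepsilon\ \text{for all } r,t\in[s,T]\}$. *)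

(* Defs.v *)
(* MathComp-Analysis.  R^m is 'rV[R]_m with the library's maximum norm; a norm
   only enters through the existence of constants, so this choice is immaterial. *)
From HB Require Import structures.
From mathcomp Require Import all_boot all_order all_algebra.
From mathcomp Require Import all_classical all_reals all_analysis.

Set Implicit Arguments.
Unset Strict Implicit.
Unset Printing Implicit Defensive.

Import Order.TTheory GRing.Theory Num.Theory.
Import numFieldNormedType.Exports.

Local Open Scope classical_set_scope.
Local Open Scope ring_scope.

Definition bounded_continuous_on (R : realType) (X : topologicalType)
    (W : normedModType R) (D : set X) (f : X -> W) : Prop :=
  {within D, continuous f} /\ exists M : R, forall p, D p -> `|f p| <= M.

Section HolderSpaces.
Context (R : realType) (W : normedModType R).
Implicit Types (mu s t : R).

(* The space C_1^mu on [s, t]. *)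
Definition holder1 mu s t (f : R -> W) : Prop :=
  exists C : R, forall u v, s <= u <= t -> s <= v <= t ->
    `|f v - f u| <= C * `|v - u| `^ mu.

(* The space C_2^mu on [s, t]; only the values h u v with u <= v matter. *)
Definition holder2 mu s t (h : R -> R -> W) : Prop :=
  [/\ {within [set p : R * R | s <= p.1 <= p.2 /\ p.2 <= t],
        continuous (fun p : R * R => h p.1 p.2)},
      forall u, s <= u <= t -> h u u = 0 &
      exists C : R, forall u v, s <= u <= v -> v <= t ->
        `|h u v| <= C * `|v - u| `^ mu].

End HolderSpaces.

Section RoughPaths.
Context (R : realType) (n : nat).
Variables (zeta : R -> 'rV[R]_n) (zeta2 : R -> R -> 'M[R]_n).

Definition geometric_rough_path (alpha T : R) : Prop :=
  [/\ holder1 alpha 0 T zeta,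
      zeta 0 = 0,
      holder2 (2 * alpha) 0 T zeta2,
      forall s u t (i j : 'I_n), 0 <= s <= u -> u <= t <= T ->
        zeta2 s t i j - zeta2 s u i j - zeta2 u t i j
        = (zeta u - zeta s) 0 i * (zeta t - zeta u) 0 j &
      forall s t (i j : 'I_n), 0 <= s <= t -> t <= T ->
        zeta2 s t i j + zeta2 s t j i
        = (zeta t - zeta s) 0 i * (zeta t - zeta s) 0 j].

(* [z'] is the derivative z^zeta; row vectors, hence the transpose. *)
Definition controlled (m : nat) (kappa s T : R)
    (z : R -> 'rV[R]_m) (z' : R -> 'M[R]_(m, n)) : Prop :=
  [/\ holder1 kappa s T z, holder1 kappa s T z' &
      holder2 (2 * kappa) s T
        (fun u v => z v - z u - (zeta v - zeta u) *m (z' u)^T)].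

(* Compensated Riemann sum over the partition s :: p of [s, t]. *)
Definition rough_sum (mu : R -> 'rV[R]_n) (mu' : R -> 'M[R]_n)
    (s t : R) (p : seq R) : R :=
  \sum_(0 <= q < size p)
    let u := nth t (s :: p) q in
    let v := nth t (s :: p) q.+1 in
    (\sum_i mu u 0 i * (zeta v - zeta u) 0 i
     + \sum_i \sum_j mu' u i j * zeta2 u v j i).

(* [I] is the integral of mu^i d zeta^i over [s, t]: the limit of the
   compensated sums as the mesh tends to 0. *)
Definition is_rough_integral (mu : R -> 'rV[R]_n) (mu' : R -> 'M[R]_n)
    (s t I : R) : Prop :=
  forall e : R, 0 < e -> exists2 delta : R, 0 < delta &
    forall p : seq R, itv_partition s t p ->
      (forall q, (q < size p)%N ->
         nth t (s :: p) q.+1 - nth t (s :: p) q < delta) ->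
      `|rough_sum mu mu' s t p - I| < e.

End RoughPaths.

Section Smoothness.
Context (R : realType) (m : nat).

(* C_b^{k,l} on [0, T] x R^m.  [D i beta] is d_t^i d_x^beta f, where the
   multi-index beta is the list of the successive directions of
   differentiation; d_t is one-sided at 0 and at T. *)
Definition Cb (k l : nat) (T : R) (f : R -> 'rV[R]_m -> R) : Prop :=
  exists D : nat -> seq 'I_m -> R -> 'rV[R]_m -> R,
  [/\ forall t x, 0 <= t <= T -> D 0%N [::] t x = f t x,
      forall beta (j : 'I_m) t x, (size beta < l)%N -> 0 <= t <= T ->
        is_derive x (delta_mx 0 j) (D 0%N beta t) (D 0%N (j :: beta) t x),
      forall i beta t x, (i < k)%N -> (size beta <= l)%N -> 0 <= t <= T ->
        (fun u => (u - t)^-1 * (D i beta u x - D i beta t x))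
          @ within `[0, T] t^' --> D i.+1 beta t x &
      forall i beta, (i <= k)%N -> (size beta <= l)%N ->
        bounded_continuous_on [set p : R * 'rV[R]_m | 0 <= p.1 <= T]
          (fun p : R * 'rV[R]_m => D i beta p.1 p.2)].

(* C_b^{0,1,1} on [0, T] x R^m x U.  As U is an arbitrary subset of R^k, the
   derivative in a is the derivative along U; for U open, its boundedness and
   continuity amount to those of the partial derivatives. *)
Definition Cb011 (k : nat) (T : R) (U : set 'rV[R]_k)
    (b : R -> 'rV[R]_m -> 'rV[R]_k -> 'rV[R]_m) : Prop :=
  let D := [set p : R * 'rV[R]_m * 'rV[R]_k | 0 <= p.1.1 <= T /\ U p.2] in
  exists (bx : 'I_m -> R -> 'rV[R]_m -> 'rV[R]_k -> 'rV[R]_m)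
         (ba : R -> 'rV[R]_m -> 'rV[R]_k -> 'M[R]_(k, m)),
  [/\ bounded_continuous_on D
        (fun p : R * 'rV[R]_m * 'rV[R]_k => b p.1.1 p.1.2 p.2),
      forall j t x a, 0 <= t <= T -> U a ->
        is_derive x (delta_mx 0 j) (fun z => b t z a) (bx j t x a),
      forall j, bounded_continuous_on D
        (fun p : R * 'rV[R]_m * 'rV[R]_k => bx j p.1.1 p.1.2 p.2),
      forall t x a, 0 <= t <= T -> U a ->
        (fun a' => `|a' - a|^-1 *:
                     (b t x a' - b t x a - (a' - a) *m ba t x a))
          @ within U a^' --> (0 : 'rV[R]_m) &
      bounded_continuous_on D
        (fun p : R * 'rV[R]_m * 'rV[R]_k => ba p.1.1 p.1.2 p.2)].

End Smoothness.

(* Measurable types are pointed in the library, whence the point [a0] of [U];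
   nothing depends on its choice. *)
Definition pointed_subset (T : Type) (U : set T) (a0 : U) : Type := set_type U.

HB.instance Definition _ (T : choiceType) (U : set T) (a0 : U) :=
  Choice.copy (pointed_subset a0) (set_type U).
HB.instance Definition _ (T : choiceType) (U : set T) (a0 : U) :=
  isPointed.Build (pointed_subset a0) a0.

Section ControlSpace.
Context (R : realType) (k : nat) (U : set 'rV[R]_k) (a0 : U).
Variable d : U -> U -> R.

Definition is_metric : Prop :=
  [/\ forall a a', 0 <= d a a',
      forall a a', d a a' = 0 <-> a = a',
      forall a a', d a a' = d a' a &
      forall a1 a2 a3, d a1 a3 <= d a1 a2 + d a2 a3].

Definition metric_open : set (set (pointed_subset a0)) :=
  [set O | forall a, O a ->
     exists2 e : R, 0 < e & forall a', d a a' < e -> O a'].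

(* The measurable space of the Borel sets of (U, d). *)
Definition control := g_sigma_algebraType metric_open.

Record P2 := MkP2 {
  P2_prob :> probability control R ;
  P2_moment : exists a1 : U,
    (\int[P2_prob]_(a in [set: control]) ((d a1 a) ^+ 2)%:E < +oo)%E }.

HB.instance Definition _ := gen_eqMixin P2.
HB.instance Definition _ := gen_choiceMixin P2.

Definition coupling (m1 m2 : P2) : set (probability (control * control)%type R)
  := [set m | forall A : set control, measurable A ->
       m (A `*` setT) = m1 A /\ m (setT `*` A) = m2 A].

Definition W2 (m1 m2 : P2) : \bar R :=
  ereal_inf [set ((\int[m]_(p in [set: control * control])
                     ((d p.1 p.2) ^+ 2)%:E) `^ (2^-1))%E
            | m in coupling m1 m2].

(* The W2-topology, so that compactness in P2 is the library's [compact]. *)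
Definition W2_open : set (set P2) :=
  [set O | forall m, O m -> exists2 e : R, 0 < e &
     forall m', (W2 m m' < e%:E)%E -> O m'].

Lemma W2_openT : W2_open setT.
Proof. by move=> m _; exists 1. Qed.

Lemma W2_openI : setI_closed W2_open.
Proof.
move=> A B oA oB m [Am Bm].
have [e1 e10 h1] := oA _ Am; have [e2 e20 h2] := oB _ Bm.
exists (Num.min e1 e2); first by rewrite lt_min e10.
move=> m' h; split.
- by apply: h1; apply: (lt_le_trans h); rewrite lee_fin ge_min lexx.
- by apply: h2; apply: (lt_le_trans h); rewrite lee_fin ge_min lexx orbT.
Qed.

Lemma W2_open_bigU (I : Type) (f : I -> set P2) :
  (forall i, W2_open (f i)) -> W2_open (\bigcup_i f i).
Proof.
move=> of_ m [i _ fim]; have [e e0 h] := of_ i _ fim.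
by exists e => // m' /h fm'; exists i.
Qed.

HB.instance Definition _ :=
  isOpenTopological.Build P2 W2_openT W2_openI W2_open_bigU.

(* The controls V^{eps,L}([s,T]); their values outside [s, T] are irrelevant. *)
Definition admissible (K : set P2) (eps L s T : R) : set (R -> P2) :=
  [set gamma | (forall r, s <= r <= T -> K (gamma r)) /\
     forall r t, s <= r <= T -> s <= t <= T ->
       (W2 (gamma r) (gamma t) <= (L * `|t - r| `^ eps)%:E)%E].

Context (m n : nat).

Definition drift (b : R -> 'rV[R]_m -> 'rV[R]_k -> 'rV[R]_m)
    (gamma : R -> P2) (x : R -> 'rV[R]_m) (s t : R) : 'rV[R]_m :=
  \row_i \int[lebesgue_measure]_(r in `[s, t])
    (\int[gamma r]_(a in [set: control])
       b r (x r) (\val (a : U)) 0 i).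

(* The fixed point equation is an identity in the space of weakly controlled
   paths, so it also fixes the derivative: x^zeta = sigma(., x).  Without this
   clause uniqueness fails, e.g. for zeta = 0 and zeta2 <> 0. *)
Definition rough_solution (zeta : R -> 'rV[R]_n) (zeta2 : R -> R -> 'M[R]_n)
    (b : R -> 'rV[R]_m -> 'rV[R]_k -> 'rV[R]_m)
    (sigma : R -> 'rV[R]_m -> 'M[R]_(m, n))
    (kappa T s : R) (y : 'rV[R]_m) (gamma : R -> P2) (x : R -> 'rV[R]_m)
    : Prop :=
  exists x' : R -> 'M[R]_(m, n),
  [/\ controlled zeta kappa s T x x',
      forall t, s <= t <= T -> x' t = sigma t (x t) &
      forall t (i : 'I_m), s <= t <= T ->
        is_rough_integral zeta zeta2
          (fun r => \row_l sigma r (x r) i l)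
          (fun r => \matrix_(l, q) \sum_(j < m)
             'D_(delta_mx 0 j) (fun z => sigma r z i l) (x r) * x' r j q)
          s t (x t 0 i - y 0 i - drift b gamma x s t 0 i)].

(* [X s y gamma] is the path x^{s,y,gamma}. *)
Definition value (F : R -> 'rV[R]_m -> P2 -> R) (G : 'rV[R]_m -> R)
    (X : R -> 'rV[R]_m -> (R -> P2) -> R -> 'rV[R]_m)
    (K : set P2) (eps L T s : R) (y : 'rV[R]_m) : R :=
  sup [set \int[lebesgue_measure]_(r in `[s, T])
             F r (X s y gamma r) (gamma r)
           + G (X s y gamma T)
      | gamma in admissible K eps L s T].

End ControlSpace.

(* Main.v *)
Require Import Defs.
From HB Require Import structures.
From mathcomp Require Import all_boot all_order all_algebra.
From mathcomp Require Import all_classical all_reals all_analysis.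
From mathcomp Require Import measurable_realfun ring lra.
Import Order.TTheory GRing.Theory Num.Theory.
Import numFieldNormedType.Exports.

(** The value is a supremum of payoffs, so it inherits every modulus of
    continuity that the payoffs have uniformly in the control.  For s1 <= s2 a
    control on [s1, T] restricts to [s2, T], and a control on [s2, T] extends to
    [s1, T] by staying at its value at s2 ([admissible_freeze]).  Hence
    [sup_dist_le] reduces the theorem to two trajectories that use the same
    control on [s2, T].  At time s2 they are within
    |y1 - y2| + O(|s2 - s1|^alpha) of each other, since over short times a
    solution is alpha-Hoelder with a constant that does not see the control; and
    from s2 on they stay that close, up to a factor, since the flow is Lipschitz
    in the initial point.  Both facts are [rough_equation_estimates].  When
    |s2 - s1| exceeds the length h of a short time, the payoffs being bounded by
    one constant is enough.

    The rough equation is treated in the manner of Davie and Gubinelli.  Let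
    beta = min(kappa, 1/2), so that 3 beta > 1 and 2 beta <= 1, and write
    tau = |v - u|^beta.  Over [u, v] a solution minus its drift minus its
    second-order Euler step leaves a remainder [euler_rem].  The rough integral
    is a limit of compensated sums, so the sums of this remainder over finer and
    finer dyadic partitions tend to 0.  Chen's relation shows that its defect
    over a midpoint ([euler_rem_defect]) is O(tau^3); as 3 beta > 1, the sewing
    argument ([sewing_bound]) makes the remainder itself O(tau^3).

    The constant in that defect involves the quantity to be estimated: a bound
    P tau^2 on the first-order remainder [controlled_rem].  Expanding sigma
    around the first-order Euler point, not around the true increment, makes the
    dependence on P linear instead of quadratic, so that on intervals of length
    h the bound P improves to C + P / 2, where C depends only on the data.
    Iterating gives 2 C ([self_improvement]).  The same scheme applied to the
    difference of two solutions with the same control ([euler_rem_dist], which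
    uses three derivatives of sigma) shows that their distance at most doubles
    over a time h, hence is multiplied by at most 2 ^ (T / h + 1) over [0, T].

    The drift and the running cost enter only through bounds on integrands.  An
    integral is here a difference of suprema of integrals of simple functions,
    and such lower integrals are additive in the domain and Lipschitz for the
    uniform distance of bounded integrands ([ler_dist_Rintegral],
    [bounded_Rintegral_setU]).  *)

Set Implicit Arguments.
Unset Strict Implicit.
Unset Printing Implicit Defensive.

Local Open Scope classical_set_scope.
Local Open Scope ring_scope.

(** * Lower integrals of bounded functions *)

Section LowerIntegral.
Context d (X : measurableType d) (R : realType).
Variable mu : {measure set X -> \bar R}.
Implicit Types (f g : X -> R) (D : set X).

Import HBNNSimple.

(** Subtracting a constant from a simple function below f + c
    gives a simple function below f; this is how a uniform perturbation of an
    integrand is moved to the simple functions that define its integral. *)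
Lemma truncation_nnsfun (h : {nnsfun X >-> R}) (c : R) :
  exists k : {nnsfun X >-> R}, forall x, k x = Num.max (h x - c) 0.
Proof.
pose k x := Num.max (h x - c) 0.
have mk : measurable_fun setT k.
  by apply: (@measurable_maxr _ _ _ _ (fun x => h x - c) (cst 0)) => //; exact: measurable_funB.
have fk : finite_set (range k).
  have -> : range k = (fun y => Num.max (y - c) 0) @` range h.
    by rewrite image_comp.
  exact: finite_image.
have k0 x : 0 <= k x by rewrite le_max lexx orbT.
pose K : {nnsfun X >-> R} := HB.pack_for {nnsfun X >-> R} k
  (isMeasurableFun.Build _ _ _ _ k mk) (FiniteImage.Build _ _ k fk)
  (isNonNegFun.Build _ _ k k0).
by exists K.
Qed.

Lemma nnsfun_le_ge0_integral D f (k : {nnsfun X >-> R}) : measurable D ->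
  (forall x, D x -> 0 <= f x) -> (forall x, D x -> k x <= f x) ->
  (\int[mu]_(x in D) (k x)%:E <= \int[mu]_(x in D) (f x)%:E)%E.
Proof.
move=> mD f0 kf; rewrite integral_nnsfun// ge0_integralE//.
rewrite mrestrict; apply: ereal_sup_ubound.
exists (proj_nnsfun k mD) => //= x; rewrite /mindic indicE /patch.
case: ifPn => [/set_mem Dx|nDx]; last by rewrite mulr0.
by rewrite mulr1 lee_fin kf.
Qed.

(** The measurable part of the inequality is done on the
    simple functions h below f: each one is at most max(h - c, 0) + c, and
    max(h - c, 0) is one of the simple functions below g. *)
Lemma ge0_le_integral_addcst D f g (c : R) : measurable D -> 0 <= c ->
  (forall x, D x -> 0 <= f x) -> (forall x, D x -> 0 <= g x) ->
  (forall x, D x -> f x <= g x + c) ->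
  (\int[mu]_(x in D) (f x)%:E <= \int[mu]_(x in D) (g x)%:E + c%:E * mu D)%E.
Proof.
move=> mD c0 f0 g0 fg; rewrite [leLHS]ge0_integralE//.
apply: ge_ereal_sup => _ /= [h hf <-].
have hD x : ~ D x -> h x = 0.
  move=> nDx; apply/eqP; rewrite eq_le fun_ge0 andbT -lee_fin.
  by move: (hf x); rewrite /patch memNset.
have -> : sintegral mu h = (\int[mu]_(x in D) (h x)%:E)%E.
  rewrite integral_nnsfun//; congr sintegral; apply/funext => x.
  by rewrite /patch; case: ifPn => // /negP; rewrite inE => /hD.
have [k kE] := truncation_nnsfun h c.
have mh (f' : {nnsfun X >-> R}) : measurable_fun D (fun x => (f' x)%:E).
  by apply/measurable_EFinP; exact: measurable_funTS.
apply: (@le_trans _ _ (\int[mu]_(x in D) ((k x)%:E + c%:E))%E).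
  apply: ge0_le_integral => //.
  - by move=> x _; rewrite lee_fin.
  - by apply: emeasurable_funD.
  - move=> x _; rewrite -EFinD lee_fin kE.
    by rewrite -lerBlDr le_max lexx.
rewrite ge0_integralD//; last first.
  by move=> x _; rewrite lee_fin.
rewrite integral_cst// leeD2r// nnsfun_le_ge0_integral// => x Dx.
rewrite kE ge_max g0// andbT lerBlDr (le_trans _ (fg _ Dx))//.
by have := hf x; rewrite /patch mem_set.
Qed.

(** A simple function below f on the union splits into its
    restrictions to A and to B; conversely simple functions below f on A and on
    B, each vanishing outside its own part, add up to one on the union. *)
Lemma ge0_lower_integral_setU A B f : measurable A -> measurable B ->
  [disjoint A & B] -> (forall x, (A `|` B) x -> 0 <= f x) ->
  (\int[mu]_(x in A `|` B) (f x)%:E =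
   \int[mu]_(x in A) (f x)%:E + \int[mu]_(x in B) (f x)%:E)%E.
Proof.
move=> mA mB AB f0.
have fA x : A x -> 0 <= f x by move=> Ax; apply: f0; left.
have fB x : B x -> 0 <= f x by move=> Bx; apply: f0; right.
have mAB : measurable (A `|` B) by exact: measurableU.
have mh D (f' : {nnsfun X >-> R}) : measurable_fun D (fun x => (f' x)%:E).
  by apply/measurable_EFinP; exact: measurable_funTS.
apply/eqP; rewrite eq_le; apply/andP; split.
  rewrite [leLHS]ge0_integralE//; apply: ge_ereal_sup => _ /= [h hf <-].
  have hD x : ~ (A `|` B) x -> h x = 0.
    move=> nDx; apply/eqP; rewrite eq_le fun_ge0 andbT -lee_fin.
    by move: (hf x); rewrite /patch memNset.
  have -> : sintegral mu h = (\int[mu]_(x in A `|` B) (h x)%:E)%E.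
    rewrite integral_nnsfun//; congr sintegral; apply/funext => x.
    by rewrite /patch; case: ifPn => // /negP; rewrite inE => /hD.
  have hf' x : (A `|` B) x -> h x <= f x.
    by move=> Dx; have := hf x; rewrite /patch mem_set.
  rewrite ge0_integral_setU//; last by move=> x _; rewrite lee_fin.
  by apply: leeD; apply: nnsfun_le_ge0_integral => // x Dx; apply: hf';
    [left|right].
have supD D (y : \bar R) (z : \bar R) : measurable D -> (0 <= z)%E ->
  (forall x, D x -> 0 <= f x) ->
  (forall h : {nnsfun X >-> R}, (forall x, (h x)%:E <= ((fun x => (f x)%:E) \_ D) x)%E ->
    (sintegral mu h + z <= y)%E) -> (\int[mu]_(x in D) (f x)%:E + z <= y)%E.
  move=> mD z0 fD H; rewrite ge0_integralE//.
  (* An infinite z cannot be moved to the other side; then h = 0 forces y = +oo. *)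
  have [zy|zfin] := eqVneq z +oo%E.
    have f0D x : ((@nnsfun0 _ X R x)%:E <= ((fun x => (f x)%:E) \_ D) x)%E.
      by rewrite /patch; case: ifPn => //= /set_mem /fD; rewrite lee_fin.
    have := H _ f0D; rewrite zy sintegral0 add0e leye_eq => /eqP ->.
    by rewrite leey.
  have zf : z \is a fin_num by rewrite ge0_fin_numE// ltey.
  rewrite -leeBrDr//; apply: ge_ereal_sup => _ /= [h hf <-].
  by rewrite leeBrDr//; exact: H.
apply: (supD) => //; first by apply: integral_ge0 => x Bx; rewrite lee_fin fB.
move=> h hA; rewrite addeC; apply: supD => //; first exact: sintegral_ge0.
move=> k kB; rewrite addeC -sintegralD// ge0_integralE//; last first.
apply: ereal_sup_ubound => /=; exists (add_nnsfun h k) => //= x.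
have := hA x; have := kB x; rewrite /patch in_setU.
case: ifPn => xB; case: ifPn => xA /=; rewrite ?lee_fin => k0 h0.
- have : x \in A `&` B by rewrite in_setI xA xB.
  by move: AB; rewrite disj_set2E => /eqP ->; rewrite inE.
- have -> : h x = 0 by apply/eqP; rewrite eq_le h0 fun_ge0.
  by rewrite add0r.
- have -> : k x = 0 by apply/eqP; rewrite eq_le k0 fun_ge0.
  by rewrite addr0.
- have -> : h x = 0 by apply/eqP; rewrite eq_le h0 fun_ge0.
  by rewrite add0r.
Qed.

Lemma max_bounded D f (M : R) : (forall x, D x -> `|f x| <= M) ->
  forall x, D x -> 0 <= Num.max (f x) 0 <= M.
Proof.
move=> fM x /fM fxM; rewrite le_max lexx orbT ge_max.
by rewrite (le_trans (ler_norm _) fxM) (le_trans _ fxM).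
Qed.

Section BoundedIntegrand.
Variable D : set X.
Hypotheses (mD : measurable D) (Dfin : (mu D < +oo)%E).

Let muD : mu D = (fine (mu D))%:E.
Proof. by rewrite fineK// ge0_fin_numE. Qed.

Lemma ge0_bounded_integral_fin_num f (M : R) :
  (forall x, D x -> 0 <= f x <= M) ->
  (\int[mu]_(x in D) (f x)%:E)%E \is a fin_num.
Proof.
move=> f0M; have [->|/set0P[x0 Dx0]] := eqVneq D set0; first by rewrite integral_set0.
have M0 : 0 <= M by have /andP[/le_trans] := f0M _ Dx0; apply.
rewrite ge0_fin_numE; last first.
  by apply: integral_ge0 => x /f0M /andP[f0 _]; rewrite lee_fin.
apply: (@le_lt_trans _ _ (\int[mu]_(x in D) (0%R)%:E + M%:E * mu D)%E).
  apply: ge0_le_integral_addcst => // x /f0M /andP[]//.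
  by rewrite add0r.
by rewrite integral0 add0e muD -EFinM ltry.
Qed.

Lemma Rintegral_pos_neg f (M : R) : (forall x, D x -> `|f x| <= M) ->
  \int[mu]_(x in D) f x =
  \int[mu]_(x in D) Num.max (f x) 0 - \int[mu]_(x in D) Num.max (- f x) 0.
Proof.
move=> fM; rewrite /Rintegral integralE -fineB.
- congr fine; congr (_ - _)%E; apply: eq_integral => x _.
  + by rewrite funeposE/= EFin_max.
  + by rewrite funenegE/= EFin_max.
- exact: ge0_bounded_integral_fin_num (max_bounded fM).
- apply: ge0_bounded_integral_fin_num (@max_bounded D (\- f) M _) => x Dx.
  by rewrite /= normrN fM.
Qed.

(** The positive and the negative part each contribute c times
    the mass of D, whence the factor 2. *)
Lemma ler_dist_Rintegral f g (M c : R) : 0 <= c ->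
  (forall x, D x -> `|f x| <= M) -> (forall x, D x -> `|g x| <= M) ->
  (forall x, D x -> `|f x - g x| <= c) ->
  `|\int[mu]_(x in D) f x - \int[mu]_(x in D) g x| <= 2 * c * fine (mu D).
Proof.
move=> c0 fM gM fg.
have half (u v : X -> R) : (forall x, D x -> `|u x| <= M) ->
    (forall x, D x -> `|v x| <= M) -> (forall x, D x -> `|u x - v x| <= c) ->
    \int[mu]_(x in D) Num.max (u x) 0 - \int[mu]_(x in D) Num.max (v x) 0
    <= c * fine (mu D).
  move=> uM vM uv; rewrite lerBlDl -lee_fin EFinD EFinM /Rintegral.
  have fin (w : X -> R) : (forall x, D x -> `|w x| <= M) ->
      (\int[mu]_(x in D) (Num.max (w x) 0)%:E)%E \is a fin_num.
    by move=> wM; exact: ge0_bounded_integral_fin_num (max_bounded wM).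
  rewrite !fineK ?fin ?ge0_fin_numE//.
  apply: ge0_le_integral_addcst => // x Dx; rewrite ?le_max ?lexx ?orbT//.
  have := uv _ Dx; rewrite ler_norml lerBlDl => /andP[_ uvc].
  rewrite ge_max (le_trans uvc) ?lerD2r ?le_max ?lexx//=.
  by rewrite addr_ge0// le_max lexx orbT.
have dN (u v : X -> R) : (forall x, D x -> `|u x - v x| <= c) ->
    forall x, D x -> `|- u x - - v x| <= c.
  by move=> uv x Dx; rewrite -opprD normrN uv.
have nM (u : X -> R) : (forall x, D x -> `|u x| <= M) ->
  forall x, D x -> `|- u x| <= M by move=> uM x Dx; rewrite normrN uM.
have gf x : D x -> `|g x - f x| <= c by move=> Dx; rewrite distrC fg.
rewrite (Rintegral_pos_neg fM) (Rintegral_pos_neg gM) ler_norml.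
have := half _ _ fM gM fg; have := half _ _ gM fM gf.
have := half _ _ (nM _ fM) (nM _ gM) (dN _ _ fg).
have := half _ _ (nM _ gM) (nM _ fM) (dN _ _ gf).
lra.
Qed.

Lemma ler_norm_Rintegral f (M : R) : 0 <= M ->
  (forall x, D x -> `|f x| <= M) ->
  `|\int[mu]_(x in D) f x| <= 2 * M * fine (mu D).
Proof.
move=> M0 fM; have -> : \int[mu]_(x in D) f x =
    \int[mu]_(x in D) f x - \int[mu]_(x in D) (cst 0 x).
  by rewrite /= /Rintegral integral0 subr0.
apply: (@ler_dist_Rintegral _ _ M) => // x Dx; first by rewrite normr0.
by rewrite subr0 fM.
Qed.

End BoundedIntegrand.

Lemma bounded_Rintegral_setU A B f (M : R) : measurable A -> measurable B ->
  (mu A < +oo)%E -> (mu B < +oo)%E -> [disjoint A & B] ->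
  (forall x, (A `|` B) x -> `|f x| <= M) ->
  \int[mu]_(x in A `|` B) f x = \int[mu]_(x in A) f x + \int[mu]_(x in B) f x.
Proof.
move=> mA mB Afin Bfin AB fM.
have mAB : measurable (A `|` B) by exact: measurableU.
have ABfin : (mu (A `|` B) < +oo)%E.
  by apply: le_lt_trans (measureU2 _ _ _) _ => //; rewrite lte_add_pinfty.
have fA x : A x -> `|f x| <= M by move=> Ax; apply: fM; left.
have fB x : B x -> `|f x| <= M by move=> Bx; apply: fM; right.
rewrite (Rintegral_pos_neg mAB ABfin fM) (Rintegral_pos_neg mA Afin fA).
rewrite (Rintegral_pos_neg mB Bfin fB) /Rintegral.
have split (u : X -> R) : (forall x, (A `|` B) x -> `|u x| <= M) ->
   fine (\int[mu]_(x in A `|` B) (Num.max (u x) 0)%:E) =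
   fine (\int[mu]_(x in A) (Num.max (u x) 0)%:E) +
   fine (\int[mu]_(x in B) (Num.max (u x) 0)%:E).
  move=> uM; rewrite ge0_lower_integral_setU//; last first.
    by move=> x _; rewrite le_max lexx orbT.
  rewrite fineD//.
    by apply: ge0_bounded_integral_fin_num => // x Ax; apply: max_bounded uM _ _; left.
  by apply: ge0_bounded_integral_fin_num => // x Bx; apply: max_bounded uM _ _; right.
rewrite !split//; last by move=> x /fM; rewrite normrN.
lra.
Qed.

End LowerIntegral.

(** * Mean value inequalities along coordinate directions *)

Section MeanValue.
Context (R : realType) (m : nat).
Implicit Types (x y h k : 'rV[R]_m).

Local Notation e_ j := (delta_mx 0 j : 'rV[R]_m).

Lemma ler_norm_entry (p q : nat) (a : 'M[R]_(p, q)) i j : `|a i j| <= `|a|.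
Proof.
by rewrite [leRHS]/Num.Def.normr/= mx_normrE; exact: (le_bigmax _ _ (i, j)).
Qed.

Lemma ler_norm_coord x j : `|x 0 j| <= `|x|.
Proof. exact: ler_norm_entry. Qed.

Lemma ler_norm_row x (M : R) : 0 <= M -> (forall j, `|x 0 j| <= M) -> `|x| <= M.
Proof.
move=> M0 xM; rewrite [leLHS]/Num.Def.normr/= mx_normrE bigmax_le// => -[i j] _.
by rewrite /= ord1.
Qed.

Lemma is_derive_along_line (f : 'rV[R]_m -> R) x v (l t : R) :
  is_derive (x + t *: v) v f l -> is_derive t 1 (fun u => f (x + u *: v)) l.
Proof.
move=> [df dfl].
have E : (fun s : R => s^-1 *: ((f \o shift (x + t *: v)) (s *: v) - f (x + t *: v))) =
  (fun s : R => s^-1 *: (((fun u => f (x + u *: v)) \o shift t) (s *: 1) -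
      (fun u => f (x + u *: v)) t)).
  apply/funext => s /=; congr (_ *: (f _ - _)).
  by rewrite [s *: 1]mulr1 scalerDl addrCA.
split; first by rewrite /derivable -E.
by rewrite -dfl /derive -E.
Qed.

Lemma mean_value_le (f df : R -> R) (M a b : R) :
  (forall t, Num.min a b <= t <= Num.max a b -> is_derive t 1 f (df t)) ->
  (forall t, Num.min a b <= t <= Num.max a b -> `|df t| <= M) ->
  `|f b - f a| <= M * `|b - a|.
Proof.
wlog ab : a b / a <= b => [H dfP dfM|].
  have [ab|/ltW ba] := leP a b; first exact: H.
  by rewrite distrC (distrC b); apply: H => //; rewrite minC maxC.
rewrite min_l// max_r// => dfP dfM.
have [||c cab ->] := @MVT_segment _ f df a b ab.
- by move=> x; rewrite in_itv/= => /andP[/ltW ax /ltW xb]; apply: dfP; rewrite ax.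
- apply: derivable_within_continuous => x; rewrite in_itv/= => /dfP dfx.
  exact: ex_derive.
by rewrite normrM ler_wpM2r// dfM.
Qed.

(** The path from y to x changes one coordinate at a time.  In the
    maximum norm all of it stays in any centred ball that contains x and y, which
    is why a bound on the partial derivatives in the ball is enough. *)
Lemma mean_value_ball (f : 'rV[R]_m -> R) (df : 'I_m -> 'rV[R]_m -> R) (M r : R) x y :
  (forall j z, `|z| <= r -> is_derive z (e_ j) f (df j z)) ->
  (forall j z, `|z| <= r -> `|df j z| <= M) ->
  `|x| <= r -> `|y| <= r -> `|f x - f y| <= m%:R * M * `|x - y|.
Proof.
move=> dfP dfM xr yr.
have r0 : 0 <= r by rewrite (le_trans _ xr).
(* z i has its first i coordinates from x and the others from y. *)
pose z (i : nat) : 'rV[R]_m := \row_j (if (j < i)%N then x 0 j else y 0 j).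
have -> : f x - f y = \sum_(i < m) (f (z i.+1) - f (z i)).
  rewrite -(big_mkord predT (fun i => f (z i.+1) - f (z i))) telescope_sumr//.
  by congr (f _ - f _); apply/rowP => j; rewrite mxE// ltn_ord.
rewrite (le_trans (ler_norm_sum _ _ _))//.
rewrite -mulrA mulr_natl -[X in _ *+ X]card_ord -sumr_const ler_sum// => i _.
have coordr j (w : R) : Num.min (x 0 j) (y 0 j) <= w <= Num.max (x 0 j) (y 0 j) ->
    `|w| <= r.
  have := le_trans (ler_norm_coord x j) xr; have := le_trans (ler_norm_coord y j) yr.
  rewrite !ler_norml => /andP[? ?] /andP[? ?] /andP[].
  rewrite ge_min le_max => /orP[?|?] /orP[?|?]; apply/andP; split; lra.
pose p : 'rV[R]_m := \row_j (if j == i then 0 else z i 0 j).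
have zE w : p + w *: e_ i = \row_j (if j == i then w else z i 0 j).
  apply/rowP => j; rewrite !mxE eqxx/=; case: eqP => _; first by rewrite add0r mulr1.
  by rewrite mulr0 addr0.
have -> : z i.+1 = p + x 0 i *: e_ i.
  rewrite zE; apply/rowP => j; rewrite !mxE ltnS leq_eqVlt.
  have [->|/negPf ji] := eqVneq j i; first by rewrite eqxx.
  by rewrite (_ : (j == i :> nat) = false).
have -> : z i = p + y 0 i *: e_ i.
  rewrite zE; apply/rowP => j; rewrite !mxE.
  by have [->|//] := eqVneq j i; rewrite ltnn.
have pr w : Num.min (y 0 i) (x 0 i) <= w <= Num.max (y 0 i) (x 0 i) ->
    `|p + w *: e_ i| <= r.
  rewrite minC maxC zE => wxy; apply: ler_norm_row => // j; rewrite !mxE.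
  case: eqP => [_|_]; first exact: coordr wxy.
  by case: ifP => _; rewrite (le_trans (ler_norm_coord _ _)).
have mv := @mean_value_le (fun w => f (p + w *: e_ i))
  (fun w => df i (p + w *: e_ i)) M (y 0 i) (x 0 i).
apply: (le_trans (mv _ _)) => [w wr|w wr|].
- by apply: is_derive_along_line; exact/dfP/pr.
- exact/dfM/pr.
- have := ler_norm_coord (x - y) i; rewrite !mxE; apply: ler_wpM2l.
  by rewrite (le_trans _ (dfM i 0 _))// normr0.
Qed.

Lemma mean_value_lipschitz (f : 'rV[R]_m -> R) (df : 'I_m -> 'rV[R]_m -> R) (M : R) :
  (forall j z, is_derive z (e_ j) f (df j z)) ->
  (forall j z, `|df j z| <= M) ->
  forall x y, `|f x - f y| <= m%:R * M * `|x - y|.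
Proof.
move=> dfP dfM x y; apply: (@mean_value_ball f df M (Num.max `|x| `|y|)) => //.
  by rewrite le_max lexx.
by rewrite le_max lexx orbT.
Qed.

Lemma is_derive_translate (f : 'rV[R]_m -> R) x h v (l : R) :
  is_derive (x + h) v f l -> is_derive x v (fun z => f (z + h)) l.
Proof.
move=> [df dfl].
have E : (fun s : R => s^-1 *: ((f \o shift (x + h)) (s *: v) - f (x + h))) =
  (fun s : R => s^-1 *: (((fun z => f (z + h)) \o shift x) (s *: v) -
      (fun z => f (z + h)) x)).
  by apply/funext => s /=; rewrite addrA.
split; first by rewrite /derivable -E.
by rewrite -dfl /derive -E.
Qed.

Lemma is_derive_linear_form (c : 'I_m -> R) x j :
  is_derive x (e_ j) (fun z => \sum_i c i * z 0 i) (c j).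
Proof.
have E : (fun s : R => s^-1 *: (((fun z => \sum_i c i * z 0 i) \o shift x) (s *: e_ j) -
      \sum_i c i * x 0 i)) @ 0^' --> c j.
  apply: cvg_trans (@cvg_cst _ (c j) _ (0^' : set_system R) _).
  apply: near_eq_cvg; near=> s.
  rewrite /= -sumrB (bigD1 j)//= big1 => [|i ij]; last first.
    by rewrite !mxE eqxx/= (negbTE ij) mulr0 add0r subrr.
  rewrite !mxE !eqxx mulr1 addr0 /GRing.scale/=.
  have s0 : s != 0 by near: s; exact: nbhs_dnbhs_neq.
  by field.
split; first by apply/cvg_ex; exists (c j).
by apply/cvg_lim.
Unshelve. all: by end_near. Qed.

End MeanValue.

(** * Vector fields with bounded derivatives *)

Section FiniteBound.
Context (R : realDomainType).

Lemma finite_bound (I : finType) (P : I -> R -> Prop) :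
  (forall i a b, a <= b -> P i a -> P i b) ->
  (forall i, exists a, P i a) -> exists2 a, 0 <= a & forall i, P i a.
Proof.
move=> Pmono Pex; have [a aP] := choice Pex.
exists (\sum_i `|a i|); first exact: sumr_ge0.
move=> i; apply: Pmono (aP i); apply: (le_trans (ler_norm _)).
by rewrite (bigD1 i)//= lerDl sumr_ge0.
Qed.

Lemma ler_norm_sum_cst (I : finType) (a : I -> R) (A : R) :
  (forall i, `|a i| <= A) -> `|\sum_i a i| <= #|I|%:R * A.
Proof.
move=> aA; rewrite (le_trans (ler_norm_sum _ _ _))// mulr_natl -sumr_const.
exact: ler_sum.
Qed.

Lemma ler_norm_dot (n : nat) (a b : 'I_n -> R) (A B : R) :
  (forall i, `|a i| <= A) -> (forall i, `|b i| <= B) ->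
  `|\sum_i a i * b i| <= n%:R * (A * B).
Proof.
move=> aA bB; rewrite -[X in X%:R]card_ord; apply: ler_norm_sum_cst => i.
by rewrite normrM ler_pM.
Qed.

End FiniteBound.

Section SmoothFields.
Context (R : realType) (m : nat) (T : R).
Implicit Types (f g : R -> 'rV[R]_m -> R) (x y h k : 'rV[R]_m).

Local Notation e_ j := (delta_mx 0 j : 'rV[R]_m).

Definition time_lipschitz f : Prop :=
  exists M : R, (forall t x, 0 <= t <= T -> `|f t x| <= M) /\
    forall s t x, 0 <= s <= T -> 0 <= t <= T -> `|f t x - f s x| <= M * `|t - s|.

Definition partials f (df : 'I_m -> R -> 'rV[R]_m -> R) : Prop :=
  forall j t x, 0 <= t <= T -> is_derive x (e_ j) (f t) (df j t x).

(** Boundedness and Lipschitz dependence on time are imposed on every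
    spatial derivative up to order l.  Since partial derivatives in this class are
    again of this kind, one order lower, the class is closed under products by
    induction on l. *)
Fixpoint smooth (l : nat) f : Prop :=
  if l is l'.+1 then time_lipschitz f /\
    exists2 df, partials f df & forall j, smooth l' (df j)
  else time_lipschitz f.

Lemma smoothW l f : smooth l.+1 f -> smooth l f.
Proof.
elim: l f => [|l IH] f [fT [df dfP dfS]] //.
by split => //; exists df => // j; apply: IH.
Qed.

Lemma smooth_time_lipschitz l f : smooth l f -> time_lipschitz f.
Proof. by case: l => // l []. Qed.

Lemma time_lipschitzD f g : time_lipschitz f -> time_lipschitz g ->
  time_lipschitz (fun t x => f t x + g t x).
Proof.
move=> [M [fM fL]] [N [gN gL]]; exists (M + N); split=> [t x tT|s t x sT tT].
  by rewrite (le_trans (ler_normD _ _))// lerD ?fM ?gN.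
rewrite (_ : _ - _ = (f t x - f s x) + (g t x - g s x)); last by ring.
by rewrite (le_trans (ler_normD _ _))// mulrDl lerD ?fL ?gL.
Qed.

Lemma time_lipschitzM f g : time_lipschitz f -> time_lipschitz g ->
  time_lipschitz (fun t x => f t x * g t x).
Proof.
move=> [M [fM fL]] [N [gN gL]].
exists (2 * (`|M| * `|N|)).
have fM' t x : 0 <= t <= T -> `|f t x| <= `|M|.
  by move=> /fM-/(_ x)/le_trans; apply; exact: ler_norm.
have gN' t x : 0 <= t <= T -> `|g t x| <= `|N|.
  by move=> /gN-/(_ x)/le_trans; apply; exact: ler_norm.
split=> [t x tT|s t x sT tT].
  rewrite normrM; apply: (@le_trans _ _ (`|M| * `|N|)).
    by rewrite ler_pM ?fM' ?gN'.
  by rewrite ler_peMl ?mulr_ge0// ler1n.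
rewrite (_ : _ - _ = f t x * (g t x - g s x) + (f t x - f s x) * g s x); last by ring.
rewrite (le_trans (ler_normD _ _))// !normrM.
have -> : 2 * (`|M| * `|N|) * `|t - s| =
  `|M| * (`|N| * `|t - s|) + (`|M| * `|t - s|) * `|N| by ring.
have fL' : `|f t x - f s x| <= `|M| * `|t - s|.
  by rewrite (le_trans (fL _ _ _ _ _))// ler_wpM2r ?ler_norm.
have gL' : `|g t x - g s x| <= `|N| * `|t - s|.
  by rewrite (le_trans (gL _ _ _ _ _))// ler_wpM2r ?ler_norm.
by rewrite lerD// ler_pM ?fM' ?gN'.
Qed.

Lemma smoothD l f g : smooth l f -> smooth l g ->
  smooth l (fun t x => f t x + g t x).
Proof.
elim: l f g => [|l IH] f g; first exact: time_lipschitzD.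
move=> [fT [df dfP dfS]] [gT [dg dgP dgS]]; split; first exact: time_lipschitzD.
exists (fun j t x => df j t x + dg j t x); last first.
  by move=> j; exact: IH (dfS j) (dgS j).
by move=> j t x tT; apply: is_deriveD; [exact: dfP|exact: dgP].
Qed.

Lemma smoothM l f g : smooth l f -> smooth l g ->
  smooth l (fun t x => f t x * g t x).
Proof.
elim: l f g => [|l IH] f g fS gS; first exact: time_lipschitzM.
move: (fS) (gS) => [fT [df dfP dfS]] [gT [dg dgP dgS]].
split; first exact: time_lipschitzM.
exists (fun j t x => f t x * dg j t x + g t x * df j t x); last first.
  move=> j; apply: smoothD; apply: IH => //.
  - exact: smoothW.
  - exact: dgS.
  - exact: smoothW.
  - exact: dfS.
by move=> j t x tT; apply: is_deriveM; [exact: dfP|exact: dgP].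
Qed.

Lemma smooth_cst l (c : R) : smooth l (fun=> cst c).
Proof.
elim: l c => [|l IH] c.
  exists `|c|; split => [//|s t x _ _].
  by rewrite subrr normr0 mulr_ge0.
split; last first.
  by exists (fun=> fun=> cst 0) => // j t x _; exact: is_derive_cst.
exact: smooth_time_lipschitz (IH c).
Qed.

Lemma smooth_sum (I : finType) l (f : I -> R -> 'rV[R]_m -> R) :
  (forall i, smooth l (f i)) -> smooth l (fun t x => \sum_i f i t x).
Proof.
move=> fS; have -> : (fun t x => \sum_i f i t x) =
    \big[(fun f g t x => f t x + g t x)/(fun=> cst 0)]_i f i.
  apply/funext => t; apply/funext => x.
  by elim/big_rec2 : _ => // i y g _ ->.
by elim/big_ind : _ => //; [exact: smooth_cst|exact: smoothD].
Qed.

Lemma partials_bounded l (df : 'I_m -> R -> 'rV[R]_m -> R) :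
  (forall j, smooth l (df j)) -> exists2 M, 0 <= M &
   forall j, (forall t x, 0 <= t <= T -> `|df j t x| <= M) /\
    forall s t x, 0 <= s <= T -> 0 <= t <= T ->
      `|df j t x - df j s x| <= M * `|t - s|.
Proof.
move=> dfS; apply: finite_bound => [j a b ab [H1 H2]|j]; last first.
  exact: smooth_time_lipschitz (dfS j).
split=> [t x tT|s t x sT tT]; first by rewrite (le_trans _ ab)// H1.
by rewrite (le_trans (H2 _ _ _ _ _))// ler_wpM2r.
Qed.

Lemma smooth_lipschitz f : smooth 1 f -> exists2 C, 0 <= C &
  forall t x y, 0 <= t <= T -> `|f t x - f t y| <= C * `|x - y|.
Proof.
move=> [_ [df dfP dfS]]; have [M M0 MP] := @partials_bounded 0 df dfS.
exists (m%:R * M); first by rewrite mulr_ge0.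
move=> t x y tT; apply: (@mean_value_lipschitz _ _ (f t) (df^~ t)) => j z.
  exact: dfP.
exact: (MP j).1.
Qed.

Lemma partials_lipschitz (df : 'I_m -> R -> 'rV[R]_m -> R) :
  (forall j, smooth 1 (df j)) -> exists2 C, 0 <= C &
  forall j t x y, 0 <= t <= T -> `|df j t x - df j t y| <= C * `|x - y|.
Proof.
move=> dfS; apply: (@finite_bound _ _ (fun j C => forall t x y, 0 <= t <= T ->
  `|df j t x - df j t y| <= C * `|x - y|)) => [j a b ab H t x y tT|j].
  by rewrite (le_trans (H _ _ _ _))// ler_wpM2r.
by have [C _ H] := smooth_lipschitz (dfS j); exists C.
Qed.

Lemma is_derive_sub_real (u v : 'rV[R]_m -> R) x w (du dv : R) :
  is_derive x w u du -> is_derive x w v dv ->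
  is_derive x w (fun z => u z - v z) (du - dv).
Proof. by move=> ? ?; apply: is_deriveB. Qed.

(** The difference f t - f s is a function of x alone whose partial
    derivatives are O(|t - s|). *)
Lemma smooth_mixed f : smooth 1 f -> exists2 C, 0 <= C &
  forall s t x y, 0 <= s <= T -> 0 <= t <= T ->
    `|(f t x - f s x) - (f t y - f s y)| <= C * `|t - s| * `|x - y|.
Proof.
move=> [_ [df dfP dfS]]; have [M M0 MP] := @partials_bounded 0 df dfS.
exists (m%:R * M); first by rewrite mulr_ge0.
move=> s t x y sT tT; rewrite -(mulrA m%:R).
apply: (@mean_value_lipschitz _ _ (fun z => f t z - f s z)
  (fun j z => df j t z - df j s z)) => j z.
  by apply: is_derive_sub_real; exact: dfP.
exact: (MP j).2.
Qed.

(** Move h to k at the fixed point x, then move x to y at the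
    fixed increment k: the increment z |-> f (z + k) - f z has partial
    derivatives O(|k|). *)
Lemma smooth_four_point f : smooth 2 f -> exists2 C, 0 <= C &
  forall t x y h k, 0 <= t <= T ->
    `|(f t (x + h) - f t x) - (f t (y + k) - f t y)|
    <= C * (`|h - k| + `|k| * `|x - y|).
Proof.
move=> fS2; have [C1 C10 L1] := smooth_lipschitz (smoothW fS2).
have [_ [df dfP dfS]] := fS2.
have [C2 C20 L2] := partials_lipschitz dfS.
exists (C1 + m%:R * C2); first by rewrite addr_ge0// mulr_ge0.
move=> t x y h k tT.
rewrite (_ : _ - _ = (f t (x + h) - f t (x + k)) +
   ((f t (x + k) - f t x) - (f t (y + k) - f t y))); last by ring.
apply: (le_trans (ler_normD _ _)).
have H1 := L1 t (x + h) (x + k) tT.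
rewrite opprD addrACA subrr add0r in H1.
have H2 : `|(f t (x + k) - f t x) - (f t (y + k) - f t y)|
    <= m%:R * (C2 * `|k|) * `|x - y|.
  apply: (@mean_value_lipschitz _ _ (fun z => f t (z + k) - f t z)
    (fun j z => df j t (z + k) - df j t z)) => j z.
    apply: is_derive_sub_real; last exact: dfP.
    by apply: is_derive_translate; exact: dfP.
  by rewrite (le_trans (L2 _ _ _ _ _))// addrC addKr.
apply: (le_trans (lerD H1 H2)).
rewrite [leRHS](_ : _ = C1 * `|h - k| + m%:R * (C2 * `|k|) * `|x - y| +
  (C1 * (`|k| * `|x - y|) + m%:R * C2 * `|h - k|)); last by ring.
by rewrite lerDl addr_ge0// !mulr_ge0.
Qed.

Definition taylor_rem f (df : 'I_m -> R -> 'rV[R]_m -> R) t x h : R :=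
  f t (x + h) - f t x - \sum_j df j t x * h 0 j.

Lemma is_derive_taylor_rem f df t x h j : partials f df -> 0 <= t <= T ->
  is_derive h (e_ j) (taylor_rem f df t x) (df j t (x + h) - df j t x).
Proof.
move=> dfP tT; apply: is_derive_sub_real; last exact: is_derive_linear_form.
rewrite -[X in is_derive _ _ _ X]subr0.
apply: is_derive_sub_real.
have -> : (fun z => f t (x + z)) = (fun z => f t (z + x)).
  by apply/funext => z; rewrite addrC.
by apply: is_derive_translate; rewrite addrC; exact: dfP.
Qed.

Lemma taylor_rem0 f df t x : taylor_rem f df t x 0 = 0.
Proof.
rewrite /taylor_rem addr0 subrr big1 ?subr0// => j _.
by rewrite mxE mulr0.
Qed.

Lemma taylor_rem_le f df : partials f df -> (forall j, smooth 1 (df j)) ->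
  exists2 C, 0 <= C & forall t x h, 0 <= t <= T ->
    `|taylor_rem f df t x h| <= C * `|h| ^+ 2.
Proof.
move=> dfP dfS; have [C C0 L] := partials_lipschitz dfS.
exists (m%:R * C); first by rewrite mulr_ge0.
move=> t x h tT; rewrite -[taylor_rem _ _ _ _ _]subr0 -(taylor_rem0 f df t x).
rewrite expr2 mulrA -(mulrA m%:R) -[X in _ * `|X|]subr0.
apply: (@mean_value_ball _ _ _ (fun j z => df j t (x + z) - df j t x) _ `|h|) => //.
- by move=> j z _; exact: is_derive_taylor_rem.
- move=> j z zh; rewrite (le_trans (L _ _ _ _ _))// addrC addKr.
  by rewrite ?subr0 ler_wpM2l.
- by rewrite normr0.
Qed.

(** Both steps are mean value inequalities in the increment z,
    whose derivative is [is_derive_taylor_rem].  From h to k at fixed x it is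
    O(|z|).  For the change from x to y at increment k, both remainders vanish at
    z = 0 and the derivative of their difference is a four-point difference of
    first derivatives.  Differentiating in x instead would bring in second
    derivatives of f in both orders. *)
Lemma taylor_rem_dist f df : partials f df -> (forall j, smooth 2 (df j)) ->
  exists2 C, 0 <= C & forall t x y h k, 0 <= t <= T ->
    `|taylor_rem f df t x h - taylor_rem f df t y k|
    <= C * ((`|h| + `|k|) * `|h - k| + `|k| ^+ 2 * `|x - y|).
Proof.
move=> dfP dfS; have [C1 C10 L1] := partials_lipschitz (fun j => smoothW (dfS j)).
have [C2 C20 L2] : exists2 C, 0 <= C & forall j t x y h k, 0 <= t <= T ->
    `|(df j t (x + h) - df j t x) - (df j t (y + k) - df j t y)|
    <= C * (`|h - k| + `|k| * `|x - y|).
  apply: (@finite_bound _ _ (fun j C => forall t x y h k, 0 <= t <= T ->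
    `|(df j t (x + h) - df j t x) - (df j t (y + k) - df j t y)|
    <= C * (`|h - k| + `|k| * `|x - y|))) => [j a b ab H t x y h k tT|j].
    by rewrite (le_trans (H _ _ _ _ _ _))// ler_wpM2r// addr_ge0 ?mulr_ge0.
  by have [C _ H] := smooth_four_point (dfS j); exists C.
exists (m%:R * C1 + m%:R * C2); first by rewrite addr_ge0// mulr_ge0.
move=> t x y h k tT.
rewrite (_ : _ - _ = (taylor_rem f df t x h - taylor_rem f df t x k) +
   (taylor_rem f df t x k - taylor_rem f df t y k)); last by ring.
apply: (le_trans (ler_normD _ _)).
have H1 : `|taylor_rem f df t x h - taylor_rem f df t x k|
    <= m%:R * (C1 * (`|h| + `|k|)) * `|h - k|.
  apply: (@mean_value_ball _ _ _ (fun j z => df j t (x + z) - df j t x) _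
    (`|h| + `|k|)).
  - by move=> j z _; exact: is_derive_taylor_rem.
  - move=> j z zh; rewrite (le_trans (L1 _ _ _ _ _))// addrC addKr.
    by rewrite ler_wpM2l.
  - by rewrite lerDl.
  - by rewrite lerDr.
have H2 : `|taylor_rem f df t x k - taylor_rem f df t y k|
    <= m%:R * (C2 * (`|k| * `|x - y|)) * `|k|.
  have := @mean_value_ball _ _ (fun z => taylor_rem f df t x z - taylor_rem f df t y z)
    (fun j z => (df j t (x + z) - df j t x) - (df j t (y + z) - df j t y))
    (C2 * (`|k| * `|x - y|)) `|k| k 0.
  rewrite /= !taylor_rem0 subrr !subr0; apply => // [j z _|j z zk|].
  - by apply: is_derive_sub_real; exact: is_derive_taylor_rem.
  - rewrite (le_trans (L2 _ _ _ _ _ _ _))// subrr normr0 add0r.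
    by rewrite ler_wpM2l// ler_wpM2r.
  - by rewrite normr0.
apply: (le_trans (lerD H1 H2)).
rewrite [leRHS](_ : _ = m%:R * (C1 * (`|h| + `|k|)) * `|h - k| +
  m%:R * (C2 * (`|k| * `|x - y|)) * `|k| +
  (m%:R * C1 * (`|k| ^+ 2 * `|x - y|) + m%:R * C2 * ((`|h| + `|k|) * `|h - k|)));
  last by ring.
by rewrite lerDl addr_ge0// !mulr_ge0 ?addr_ge0 ?exprn_ge0.
Qed.

End SmoothFields.

Section MultiIndexDerivatives.
Context (R : realType) (m : nat) (T : R).

(** At an interior point the punctured neighbourhoods within
    [a, b] are those of the line. *)
Lemma is_derive_within_itv (f : R -> R) (a b c l : R) : a < c < b ->
  (fun u => (u - c)^-1 * (f u - f c)) @ within `[a, b] c^' --> l ->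
  is_derive c 1 f l.
Proof.
move=> /andP[ac cb] fl.
have E : (fun h : R => h^-1 *: ((f \o shift c) (h *: 1) - f c)) @ 0^' --> l.
  apply/cvgrPdist_le => e e0.
  have /cvgrPdist_le /(_ e e0) [/= r r0 H] := fl.
  exists (Num.min r (Num.min (c - a) (b - c))).
    by rewrite /= !lt_min r0 !subr_gt0 ac.
  move=> h /=; rewrite sub0r normrN !lt_min => /and3P[hr ha hb] h0.
  rewrite [h *: 1]mulr1.
  have := H (h + c); rewrite /= addrK; apply.
  - by rewrite opprD addrCA subrr addr0 normrN.
  - by rewrite -subr_eq0 addrK.
  - by move: ha hb; rewrite in_itv/= !ltr_norml => /andP[? ?] /andP[? ?];
      apply/andP; split; lra.
split; first by apply/cvg_ex; exists l.
exact/cvg_lim.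
Qed.

Lemma continuous_within_slice (S : set (R * 'rV[R]_m)) (F : R * 'rV[R]_m -> R)
    (s t : R) x : (forall u, s <= u <= t -> S (u, x)) ->
  {within S, continuous F} -> {within `[s, t], continuous (fun u => F (u, x))}.
Proof.
move=> st /subspace_continuousP cF; apply/subspace_continuousP => u ust.
have Sux : S (u, x) by apply: st; move: ust; rewrite /= in_itv.
apply: cvg_trans (cF _ Sux) => P /=.
rewrite /fmap /within/= /prop_near1 => -[[A B] [/= Au Bx] AB].
apply: filterS Au => v Av; rewrite in_itv/= => /st Svx.
by apply: (AB (v, x)) => //; split => //; exact: nbhs_singleton.
Qed.

(** Each D 0 beta is Lipschitz in time by the mean value theorem: D 1 beta
    is its time derivative in the open interval and is bounded. *)
Lemma Cb_smooth (f : R -> 'rV[R]_m -> R) (l : nat) : Cb 1 l.+1 T f ->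
  smooth T l.+1 f /\ exists2 df, partials T f df &
    (forall j, smooth T l (df j)) /\
    forall j t x, 0 <= t <= T -> 'D_(delta_mx 0 j) (f t) x = df j t x.
Proof.
move=> [D [D0 Dx Dt DC]].
have Dlip beta : (size beta <= l.+1)%N -> time_lipschitz T (D 0%N beta).
  move=> sb; have [cD [M0 D0M]] := DC 0%N beta isT sb.
  have [_ [M1 D1M]] := DC 1%N beta isT sb.
  exists (Num.max M0 M1); split=> [t x tT|s t x].
    by rewrite le_max (D0M (t, x)).
  have main (s' t' : R) : s' <= t' -> 0 <= s' <= T -> 0 <= t' <= T ->
      `|D 0%N beta t' x - D 0%N beta s' x| <= Num.max M0 M1 * `|t' - s'|.
    move=> st /andP[s0 sT] /andP[t0 tT].
    have [u ust||] := @MVT_segment R (fun u => D 0%N beta u x)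
      (fun u => D 1%N beta u x) s' t' st.
    - move: ust; rewrite in_itv/= => /andP[su ut].
      apply: (@is_derive_within_itv _ 0 T).
        by rewrite (le_lt_trans s0 su) (lt_le_trans ut tT).
      apply: Dt => //.
      by rewrite (le_trans s0 (ltW su)) (le_trans (ltW ut) tT).
    - have := @continuous_within_slice [set p | 0 <= p.1 <= T]
        (fun p => D 0%N beta p.1 p.2) s' t' x _ cD.
      apply=> u /andP[su ut] /=.
      by rewrite (le_trans s0 su) (le_trans ut tT).
    - move=> c; rewrite in_itv/= => /andP[sc ct] ->.
      rewrite normrM ler_wpM2r// le_max (D1M (c, x)) ?orbT//=.
      by rewrite (le_trans s0 sc) (le_trans ct tT).
  move=> sT tT; have [st|/ltW ts] := leP s t; first exact: main.
  by rewrite distrC (distrC t); exact: main.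
have Dsm k beta : (size beta + k <= l.+1)%N -> smooth T k (D 0%N beta).
  elim: k beta => [|k IH] beta sb.
    by apply: Dlip; rewrite addn0 in sb.
  split; first by apply: Dlip; rewrite (leq_trans _ sb)// leq_addr.
  exists (fun j => D 0%N (j :: beta)).
    move=> j t x tT; apply: Dx => //.
    by rewrite (leq_trans _ sb)// addnS ltnS leq_addr.
  by move=> j; apply: IH; rewrite /= addSnnS.
have fE t : 0 <= t <= T -> f t = D 0%N [::] t.
  by move=> tT; apply/funext => x; rewrite D0.
have fP : partials T f (fun j => D 0%N [:: j]).
  by move=> j t x tT; rewrite (fE t tT); exact: Dx.
have fS j : smooth T l (D 0%N [:: j]) by exact: Dsm.
split; last first.
  exists (fun j => D 0%N [:: j]) => //; split => // j t x tT.
  by have := fP j t x tT => ?; exact: derive_val.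
split; last by exists (fun j => D 0%N [:: j]).
have [M [B L]] := Dlip [::] isT; exists M; split=> [t x tT|s t x sT tT].
  by rewrite (fE t tT) B.
by rewrite (fE t tT) (fE s sT) L.
Qed.

End MultiIndexDerivatives.

(** * Dyadic sums and the increments of a rough integral *)

Section DyadicSums.
Context (R : realType).
Implicit Types (h : R -> R -> R) (s t u v : R) (p : seq R).

Fixpoint chain_sum h s p : R :=
  if p is a :: p' then h s a + chain_sum h a p' else 0.

(** The points of the n-th dyadic partition of [u, v], u excluded and v
    included: the format of [itv_partition]. *)
Fixpoint dyadic (n : nat) u v : seq R :=
  if n is n'.+1 then dyadic n' u ((u + v) / 2) ++ dyadic n' ((u + v) / 2) v
  else [:: v].

Fixpoint dyadic_sum (n : nat) h u v : R :=
  if n is n'.+1 then dyadic_sum n' h u ((u + v) / 2) + dyadic_sum n' h ((u + v) / 2) v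
  else h u v.

Lemma chain_sum_cat h s p q :
  chain_sum h s (p ++ q) = chain_sum h s p + chain_sum h (last s p) q.
Proof. by elim: p s => [|a p IH] s /=; rewrite ?add0r// IH addrA. Qed.

Lemma last_dyadic n u v a : last a (dyadic n u v) = v.
Proof. by elim: n u v a => [|n IH] u v a //=; rewrite last_cat !IH. Qed.

Lemma chain_sum_dyadic h n u v : chain_sum h u (dyadic n u v) = dyadic_sum n h u v.
Proof.
elim: n u v => [|n IH] u v /=; first by rewrite addr0.
by rewrite chain_sum_cat last_dyadic !IH.
Qed.

Lemma path_dyadic n u v : u < v -> path <%O u (dyadic n u v).
Proof.
elim: n u v => [|n IH] u v uv /=; first by rewrite uv.
by rewrite cat_path last_dyadic !IH//; lra.
Qed.

Lemma mesh_dyadic n u v (e : R) : v - u < e * 2 ^+ n ->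
  path (fun a b => b - a < e) u (dyadic n u v).
Proof.
elim: n u v => [|n IH] u v uve /=; first by rewrite expr0 mulr1 in uve; rewrite uve.
by rewrite exprS in uve; rewrite cat_path last_dyadic !IH//; lra.
Qed.

Lemma dyadic_mesh_exists (e x : R) : 0 < e ->
  exists N, forall n, (N <= n)%N -> x < e * 2 ^+ n.
Proof.
move=> e0; exists (Num.trunc (`|x| / e)).+1 => n Nn.
rewrite mulrC -ltr_pdivrMr//; apply: (@le_lt_trans _ _ (`|x| / e)).
  by rewrite ler_pM2r ?invr_gt0// ler_norm.
have := truncnS_gt (`|x| / e); move=> /lt_trans; apply.
rewrite -natrX ltr_nat; apply: leq_ltn_trans Nn _; exact: ltn_expl.
Qed.

Lemma eq_dyadic_sum h1 h2 n u v : u <= v ->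
  (forall a b, u <= a -> a <= b -> b <= v -> h1 a b = h2 a b) ->
  dyadic_sum n h1 u v = dyadic_sum n h2 u v.
Proof.
elim: n u v => [|n IH] u v uv h12 /=; first exact: h12.
have [um mv] : u <= (u + v) / 2 /\ (u + v) / 2 <= v by split; lra.
congr (_ + _); apply: IH => // a b ua ab bv; apply: h12 => //.
  exact: le_trans mv.
exact: le_trans ua.
Qed.

Lemma dyadic_sumB h1 h2 n u v :
  dyadic_sum n (fun a b => h1 a b - h2 a b) u v =
  dyadic_sum n h1 u v - dyadic_sum n h2 u v.
Proof. by elim: n u v => [|n IH] u v //=; rewrite !IH; ring. Qed.

Lemma dyadic_sum_increment (f : R -> R) n u v :
  dyadic_sum n (fun a b => f b - f a) u v = f v - f u.
Proof. by elim: n u v => [|n IH] u v //=; rewrite !IH; ring. Qed.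

Lemma dyadic_sum_diag h n u : h u u = 0 -> dyadic_sum n h u u = 0.
Proof.
move=> huu; elim: n => [|n IH] //=.
by rewrite (_ : (u + u) / 2 = u) ?IH ?addr0//; field.
Qed.

(** Passing from level n to level n + 1 costs one defect on [u, v] and
    the errors of level n on the two halves; a weight w that satisfies the
    inequality on c absorbs both. *)
Lemma dyadic_sewing h (w : R -> R -> R) (K c a b : R) : 0 <= K ->
  (forall u v, a <= u -> u <= v -> v <= b ->
     `|h u v - h u ((u + v) / 2) - h ((u + v) / 2) v| <= K * w u v) ->
  (forall u v, u <= v -> v <= b ->
     c * (w u ((u + v) / 2) + w ((u + v) / 2) v) + w u v <= c * w u v) ->
  (forall u v, u <= v -> 0 <= w u v) -> 0 <= c ->
  forall n u v, a <= u -> u <= v -> v <= b ->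
    `|dyadic_sum n h u v - h u v| <= c * K * w u v.
Proof.
move=> K0 hK wc w0 c0; elim=> [|n IH] u v au uv vb.
  by rewrite /= subrr normr0 !mulr_ge0// w0.
set m := (u + v) / 2.
have [um mv] : u <= m /\ m <= v by rewrite /m; split; lra.
have am : a <= m by exact: le_trans um.
have mb : m <= b by exact: le_trans vb.
rewrite [dyadic_sum _ _ _ _]/= -/m.
rewrite (_ : _ - _ = (dyadic_sum n h u m - h u m) + (dyadic_sum n h m v - h m v)
  - (h u v - h u m - h m v)); last by ring.
apply: (le_trans (ler_normB _ _)).
apply: (le_trans (lerD (ler_normD _ _) (lexx _))).
apply: (le_trans (lerD (lerD (IH _ _ _ _ _) (IH _ _ _ _ _)) (hK _ _ _ _ _))) => //.
have := ler_wpM2l K0 (wc _ _ uv vb); rewrite -/m; lra.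
Qed.

End DyadicSums.

Section RoughIntegralIncrements.
Context (R : realType) (n : nat).
Variables (zeta : R -> 'rV[R]_n) (zeta2 : R -> R -> 'M[R]_n).

Definition compensated_term (mu : R -> 'rV[R]_n) (mu' : R -> 'M[R]_n) (u v : R) : R :=
  \sum_i mu u 0 i * (zeta v - zeta u) 0 i + \sum_i \sum_j mu' u i j * zeta2 u v j i.

Lemma rough_sum_chain_sum mu mu' s t p :
  rough_sum zeta zeta2 mu mu' s t p = chain_sum (compensated_term mu mu') s p.
Proof.
rewrite /rough_sum; elim: p s => [|a p IH] s; first by rewrite big_geq.
by rewrite /= big_nat_recl//= -IH.
Qed.

(** Only integrals from s are known to exist.  A fine
    dyadic partition of [s, u] followed by one of [u, v] is a fine partition of
    [s, v], so the sums over [u, v] tend to the difference of the integrals. *)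
Lemma dyadic_sum_rough_integral mu mu' (I : R -> R) (s T : R) :
  (forall u, s <= u <= T -> zeta2 u u = 0) ->
  (forall t, s <= t <= T -> is_rough_integral zeta zeta2 mu mu' s t (I t)) ->
  forall u v, s <= u -> u <= v -> v <= T -> forall e, 0 < e ->
  exists N, forall k, (N <= k)%N ->
    `|dyadic_sum k (compensated_term mu mu') u v - (I v - I u)| <= e.
Proof.
move=> z0 intI u v su uv vT e e0.
move: uv; rewrite le_eqVlt => /predU1P[uv|uv].
  have uT : s <= u <= T by rewrite su uv.
  rewrite -uv; exists 0%N => k _; rewrite dyadic_sum_diag ?subrr ?normr0 ?ltW//.
  rewrite /compensated_term z0// subrr !big1 ?addr0// => i _.
    by rewrite big1// => j _; rewrite mxE mulr0.
  by rewrite mxE mulr0.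
have e2 : 0 < e / 2 by rewrite divr_gt0.
have [|du du0 Hu] := intI u _ (e / 2) e2; first by rewrite su (le_trans (ltW uv)).
have [|dv dv0 Hv] := intI v _ (e / 2) e2; first by rewrite vT (le_trans su (ltW uv)).
pose dl := Num.min du dv.
have dl0 : 0 < dl by rewrite lt_min du0.
have meshP t (p : seq R) r : path (fun a b => b - a < dl) r p ->
    forall q, (q < size p)%N -> nth t (r :: p) q.+1 - nth t (r :: p) q < dl.
  by move=> /(pathP t) H q qp; exact: H.
have [p [[path_p last_p] mesh_p]] : exists p : seq R,
    itv_partition s u p /\ path (fun a b => b - a < dl) s p.
  move: su; rewrite le_eqVlt => /predU1P[<-|su].
    by exists [::]; split => //; split => //=.
  have [N HN] := dyadic_mesh_exists (u - s) dl0.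
  exists (dyadic N s u); split; last by apply: mesh_dyadic; exact: HN.
  by split; [exact: path_dyadic|rewrite last_dyadic].
have [N HN] := dyadic_mesh_exists (v - u) dl0.
exists N => k Nk.
have mesh_k : path (fun a b => b - a < dl) u (dyadic k u v).
  by apply: mesh_dyadic; exact: HN.
have Hp := Hu p _ _; have Hq := Hv (p ++ dyadic k u v) _ _.
have {Hp} : `|rough_sum zeta zeta2 mu mu' s u p - I u| < e / 2.
  apply: Hp => // q qp; apply: lt_le_trans (meshP u p s mesh_p q qp) _.
  by rewrite ge_min lexx.
have {Hq} : `|rough_sum zeta zeta2 mu mu' s v (p ++ dyadic k u v) - I v| < e / 2.
  apply: Hq.
    by split; rewrite ?cat_path ?last_cat (eqP last_p) ?path_p ?path_dyadic ?last_dyadic.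
  move=> q qp; apply: lt_le_trans (meshP v _ s _ q qp) _.
    by rewrite cat_path mesh_p (eqP last_p).
  by rewrite ge_min lexx orbT.
rewrite !rough_sum_chain_sum chain_sum_cat (eqP last_p) chain_sum_dyadic.
rewrite !ltr_norml ler_norml => /andP[? ?] /andP[? ?].
by apply/andP; split; lra.
Qed.

End RoughIntegralIncrements.

(** * Self-improving bounds and Hoelder weights *)

Section SelfImprovement.
Context (R : realType).

(** Iterating the step on an arbitrary initial bound P0 gives
    2 C + P0 / 2 ^ k for every k. *)
Lemma self_improvement (I : Type) (S : I -> Prop) (q w : I -> R) (C P0 : R) :
  (forall i, S i -> 0 <= w i) -> 0 <= C -> 0 <= P0 ->
  (forall i, S i -> q i <= P0 * w i) ->
  (forall P, 0 <= P -> (forall i, S i -> q i <= P * w i) ->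
     forall i, S i -> q i <= (C + P / 2) * w i) ->
  forall i, S i -> q i <= 2 * C * w i.
Proof.
move=> w0 C0 P00 qP0 step.
have iter k : forall i, S i -> q i <= (2 * C + P0 / 2 ^+ k) * w i.
  elim: k => [|k IH] i Si.
    apply: (le_trans (qP0 i Si)); rewrite ler_wpM2r ?w0// expr0 divr1 lerDr.
    by rewrite mulr_ge0.
  have := step (2 * C + P0 / 2 ^+ k) _ IH i Si.
  have k0 : 0 <= P0 / 2 ^+ k by rewrite divr_ge0// exprn_ge0.
  have -> : 2 * C + P0 / 2 ^+ k.+1 = C + (2 * C + P0 / 2 ^+ k) / 2.
    have ? : (2 : R) ^+ k != 0 by rewrite expf_neq0.
    by rewrite exprS; field.
  by apply; rewrite addr_ge0// mulr_ge0.
move=> i Si; rewrite leNgt; apply/negP => lt_q.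
have e0 : 0 < q i - 2 * C * w i by rewrite subr_gt0.
have [N /(_ N (leqnn N))] := dyadic_mesh_exists (P0 * w i) e0.
have N0 : 0 < (2 : R) ^+ N by rewrite exprn_gt0.
rewrite -ltr_pdivrMr//; have := iter N i Si.
rewrite mulrDl (mulrAC P0); lra.
Qed.

End SelfImprovement.

Section HolderWeight.
Context (R : realType) (beta : R).
Hypothesis hbeta : 3^-1 < beta <= 2^-1.

Definition holder_weight (u v : R) : R := (v - u) `^ beta.
Local Notation tau := holder_weight.

Let beta0 : 0 < beta.
Proof. by case/andP: hbeta => + _; apply: lt_trans; rewrite invr_gt0. Qed.

Lemma holder_weight_ge0 u v : 0 <= tau u v.
Proof. exact: powR_ge0. Qed.

Lemma holder_weight_le u v u' v' : u' <= u -> u <= v -> v <= v' ->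
  tau u v <= tau u' v'.
Proof.
move=> uu uv vv; apply: ge0_ler_powR; rewrite ?nnegrE; [exact: ltW|lra|lra|lra].
Qed.

Lemma length_le_holder_weight u v : u <= v -> v - u <= 1 -> v - u <= tau u v ^+ 2.
Proof.
move=> uv vu1; have := uv; rewrite -subr_ge0 le_eqVlt => /predU1P[<-|vu0].
  by rewrite exprn_ge0// holder_weight_ge0.
rewrite -powR_mulrn ?holder_weight_ge0// /tau -powRrM.
apply: ger1_powR; first by rewrite vu0.
by case/andP: hbeta => _; lra.
Qed.

(** Halving an interval multiplies tau ^ 3 by l = 2 ^ (- 3 beta),
    which is less than 1/2 because 3 beta > 1; then c = 1 / (1 - 2 l). *)
Lemma holder_weight_sewing : exists2 c, 0 <= c & forall u v, u <= v ->
  c * (tau u ((u + v) / 2) ^+ 3 + tau ((u + v) / 2) v ^+ 3) + tau u v ^+ 3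
  <= c * tau u v ^+ 3.
Proof.
pose l : R := (2^-1 `^ beta) ^+ 3.
have l12 : l < 2^-1.
  rewrite /l -powR_mulrn ?powR_ge0// -powRrM -[ltRHS]powRr1 ?invr_ge0//.
  have h2 : (2^-1 == 0 :> R) = false by rewrite invr_eq0 pnatr_eq0.
  case/andP: hbeta => b3 _; rewrite /powR h2 ltr_expR ltr_nM2r; first by lra.
  by apply: ln_lt0; rewrite invr_gt0 ltr0n invf_lt1 ?ltr1n.
exists (1 - 2 * l)^-1; first by rewrite invr_ge0; lra.
move=> u v uv.
have half w : 0 <= w -> ((w / 2) `^ beta) ^+ 3 = l * (w `^ beta) ^+ 3.
  by move=> w0; rewrite powRM ?invr_ge0// exprMn mulrC.
have -> : tau u ((u + v) / 2) ^+ 3 = l * tau u v ^+ 3.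
  by rewrite -half ?subr_ge0//; congr ((_ `^ _) ^+ _); field.
have -> : tau ((u + v) / 2) v ^+ 3 = l * tau u v ^+ 3.
  by rewrite -half ?subr_ge0//; congr ((_ `^ _) ^+ _); field.
rewrite le_eqVlt; apply/orP; left; apply/eqP.
by field; rewrite gt_eqF//; lra.
Qed.

Lemma holder_weight_small (eta : R) : 0 < eta -> exists h, [/\ 0 < h, h <= 1 &
  forall u v, u <= v -> v - u <= h -> tau u v <= eta].
Proof.
move=> eta0; exists (Num.min 1 (eta `^ beta^-1)); split.
- by rewrite lt_min ltr01 powR_gt0.
- by rewrite ge_min lexx.
- move=> u v uv; rewrite le_min => /andP[_ uvh].
  rewrite -[leRHS](powRr1 (ltW eta0)) -(mulVf (lt0r_neq0 beta0)) powRrM.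
  by apply: ge0_ler_powR; rewrite ?nnegrE ?subr_ge0 ?powR_ge0//; exact: ltW.
Qed.

End HolderWeight.

(** * Rough equations: expansions and a priori bounds *)

Ltac nonneg := repeat first [assumption | exact: ler0n | exact: ler01
  | apply: addr_ge0 | apply: mulr_ge0 | apply: exprn_ge0].

Section RoughEquation.
Context (R : realType) (m n : nat) (T beta : R).
Hypothesis hbeta : 3^-1 < beta <= 2^-1.
Local Notation tau := (holder_weight beta).

Record rough_driver (Z : R) (zeta : R -> 'rV[R]_n) (zeta2 : R -> R -> 'M[R]_n)
    : Prop := RoughDriver {
  driver_incr : forall u v l, 0 <= u -> u <= v -> v <= T ->
    `|(zeta v - zeta u) 0 l| <= Z * tau u v;
  driver_area : forall u v q l, 0 <= u -> u <= v -> v <= T ->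
    `|zeta2 u v q l| <= Z * tau u v ^+ 2;
  driver_chen : forall u w v q l, 0 <= u -> u <= w -> w <= v -> v <= T ->
    zeta2 u v q l = zeta2 u w q l + zeta2 w v q l
      + (zeta w - zeta u) 0 q * (zeta v - zeta w) 0 l }.

(** The components of D sigma (sigma), the coefficient of the area in
    the second-order Euler step. *)
Definition field_along (sg : 'I_m -> 'I_n -> R -> 'rV[R]_m -> R)
    (dsg : 'I_m -> 'I_n -> 'I_m -> R -> 'rV[R]_m -> R)
    (i : 'I_m) (l q : 'I_n) (t : R) (x : 'rV[R]_m) : R :=
  \sum_j dsg i l j t x * sg j q t x.

Record first_order_bounds (A : R) (f : R -> 'rV[R]_m -> R) : Prop :=
  FirstOrderBounds {
  fo_bdd : forall t x, 0 <= t <= T -> `|f t x| <= A;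
  fo_time : forall s t x, 0 <= s <= T -> 0 <= t <= T ->
    `|f t x - f s x| <= A * `|t - s|;
  fo_lip : forall t x y, 0 <= t <= T -> `|f t x - f t y| <= A * `|x - y|;
  fo_mixed : forall s t x y, 0 <= s <= T -> 0 <= t <= T ->
    `|(f t x - f s x) - (f t y - f s y)| <= A * `|t - s| * `|x - y| }.

(** One constant A collects every estimate on the vector fields that
    the expansions use.  [field_along] loses one derivative with respect to
    sigma, so a four-point bound is the best available for it, while sigma has
    the finer [sg_taylor_dist]. *)
Record field_bounds (A : R) (sg : 'I_m -> 'I_n -> R -> 'rV[R]_m -> R)
    (dsg : 'I_m -> 'I_n -> 'I_m -> R -> 'rV[R]_m -> R) : Prop := FieldBounds {
  sg_fo : forall i l, first_order_bounds A (sg i l);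
  dsg_fo : forall i l j, first_order_bounds A (dsg i l j);
  fa_fo : forall i l q, first_order_bounds A (field_along sg dsg i l q);
  sg_taylor : forall i l t x h, 0 <= t <= T ->
    `|taylor_rem (sg i l) (dsg i l) t x h| <= A * `|h| ^+ 2;
  sg_taylor_dist : forall i l t x y h k, 0 <= t <= T ->
    `|taylor_rem (sg i l) (dsg i l) t x h - taylor_rem (sg i l) (dsg i l) t y k|
    <= A * ((`|h| + `|k|) * `|h - k| + `|k| ^+ 2 * `|x - y|);
  fa_four_point : forall i l q t x y h k, 0 <= t <= T ->
    `|(field_along sg dsg i l q t (x + h) - field_along sg dsg i l q t x) -
      (field_along sg dsg i l q t (y + k) - field_along sg dsg i l q t y)|
    <= A * (`|h - k| + `|k| * `|x - y|) }.

Variables (Z A : R) (zeta : R -> 'rV[R]_n) (zeta2 : R -> R -> 'M[R]_n).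
Variables (sg : 'I_m -> 'I_n -> R -> 'rV[R]_m -> R)
  (dsg : 'I_m -> 'I_n -> 'I_m -> R -> 'rV[R]_m -> R).
Hypotheses (Z0 : 0 <= Z) (A0 : 0 <= A).
Hypothesis hz : rough_driver Z zeta zeta2.
Hypothesis hs : field_bounds A sg dsg.

Local Notation fa := (field_along sg dsg).
Local Notation dz u v l := ((zeta v - zeta u) 0 l).

Implicit Types (x y D E : R -> 'rV[R]_m).

Definition first_order x (u v : R) : 'rV[R]_m :=
  \row_i \sum_l sg i l u (x u) * dz u v l.

Definition second_order x i (u v : R) : R :=
  \sum_l \sum_q fa i l q u (x u) * zeta2 u v q l.

(** The remainder of x as a path controlled by zeta, the derivative
    being sigma along x. *)
Definition controlled_rem x (u v : R) : 'rV[R]_m := x v - x u - first_order x u v.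

Definition euler_rem x D (i : 'I_m) (u v : R) : R :=
  (x v - x u) 0 i - (D v - D u) 0 i - (first_order x u v 0 i + second_order x i u v).

(** A solution in increment form, which makes sense on every
    subinterval and for a drift given by its increments.  The first clause is
    qualitative: the bound P depends on the solution. *)
Definition davie_solution (s : R) x D : Prop :=
  (exists2 P, 0 <= P & forall u v, s <= u -> u <= v -> v <= T ->
     `|controlled_rem x u v| <= P * tau u v ^+ 2) /\
  forall i u v, s <= u -> u <= v -> v <= T -> forall e, 0 < e ->
    exists N, forall k, (N <= k)%N -> `|dyadic_sum k (euler_rem x D i) u v| <= e.

(** The remainder of sigma along x as a controlled path. *)
Definition gubinelli_rem x i l (u w : R) : R :=
  sg i l w (x w) - sg i l u (x u) - \sum_q fa i l q u (x u) * dz u w q.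

(** The increments of x and of the drift are additive, so only the
    Euler step has a defect; Chen's relation turns the defect of the area term
    into the first-order part of [gubinelli_rem]. *)
Lemma euler_rem_defect x D i u w v :
  0 <= u -> u <= w -> w <= v -> v <= T ->
  euler_rem x D i u v - euler_rem x D i u w - euler_rem x D i w v =
  \sum_l gubinelli_rem x i l u w * dz w v l +
  \sum_l \sum_q (fa i l q w (x w) - fa i l q u (x u)) * zeta2 w v q l.
Proof.
move=> u0 uw wv vT; rewrite /euler_rem /second_order !mxE.
suff : \sum_l sg i l u (x u) * dz u v l + second_order x i u v =
   (\sum_l sg i l u (x u) * dz u w l + second_order x i u w) +
   (\sum_l sg i l w (x w) * dz w v l + second_order x i w v) -
   (\sum_l gubinelli_rem x i l u w * dz w v l +
   \sum_l \sum_q (fa i l q w (x w) - fa i l q u (x u)) * zeta2 w v q l).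
  by rewrite /second_order; lra.
rewrite /second_order -!big_split/= -sumrB; apply: eq_bigr => l _.
rewrite /gubinelli_rem mulrBl mulr_suml.
have -> : \sum_q fa i l q u (x u) * zeta2 u v q l =
   \sum_q fa i l q u (x u) * zeta2 u w q l + \sum_q fa i l q u (x u) * zeta2 w v q l
   + \sum_q fa i l q u (x u) * dz u w q * dz w v l.
  rewrite -!big_split/=; apply: eq_bigr => q _.
  by rewrite (driver_chen hz q l u0 uw wv vT); ring.
have -> : \sum_q (fa i l q w (x w) - fa i l q u (x u)) * zeta2 w v q l =
  \sum_q fa i l q w (x w) * zeta2 w v q l - \sum_q fa i l q u (x u) * zeta2 w v q l.
  by rewrite -sumrB; apply: eq_bigr => q _; rewrite mulrBl.
have -> : dz u v l = dz u w l + dz w v l by rewrite !mxE; ring.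
ring.
Qed.

Lemma sum_fa_first_order x i l u w :
  \sum_q fa i l q u (x u) * dz u w q =
  \sum_j dsg i l j u (x u) * first_order x u w 0 j.
Proof.
under eq_bigr do rewrite /field_along mulr_suml.
rewrite exchange_big; apply: eq_bigr => j _.
by rewrite mxE mulr_sumr; apply: eq_bigr => q _; rewrite mulrA.
Qed.

Lemma controlled_remE x u v : x v = x u + (first_order x u v + controlled_rem x u v).
Proof. by rewrite /controlled_rem (addrC (first_order _ _ _)) subrK addrC subrK. Qed.

(** Expanding at the Euler point x u + first_order x u w keeps
    the contribution of [controlled_rem] Lipschitz: it is the middle term, linear
    in the unknown bound, and the Taylor remainder only involves the known
    first-order term. *)
Lemma gubinelli_rem_split x i l u w : gubinelli_rem x i l u w =
  (sg i l w (x w) - sg i l u (x w)) +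
  (sg i l u (x w) - sg i l u (x u + first_order x u w)) +
  taylor_rem (sg i l) (dsg i l) u (x u) (first_order x u w).
Proof. by rewrite /gubinelli_rem sum_fa_first_order /taylor_rem; ring. Qed.

(** Expanding at the true increment is suited to differences of
    two solutions, for which Hoelder bounds on both are already available: the
    Taylor remainder is then compared by [sg_taylor_dist] and the rest is linear
    in [controlled_rem]. *)
Lemma gubinelli_rem_taylor x i l u w : gubinelli_rem x i l u w =
  (sg i l w (x w) - sg i l u (x w)) +
  taylor_rem (sg i l) (dsg i l) u (x u) (x w - x u) +
  \sum_j dsg i l j u (x u) * controlled_rem x u w 0 j.
Proof.
rewrite /gubinelli_rem sum_fa_first_order /taylor_rem (addrC (x u)) subrK.
have -> : \sum_j dsg i l j u (x u) * (x w - x u) 0 j =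
  \sum_j dsg i l j u (x u) * first_order x u w 0 j +
  \sum_j dsg i l j u (x u) * controlled_rem x u w 0 j.
  rewrite -big_split/=; apply: eq_bigr => j _; rewrite -mulrDr; congr (_ * _).
  by rewrite /controlled_rem !mxE; ring.
ring.
Qed.

Let B := n%:R * (A * Z).
Let B0 : 0 <= B. Proof. by rewrite !mulr_ge0. Qed.

Lemma first_order_le x u v : 0 <= u -> u <= v -> v <= T ->
  `|first_order x u v| <= B * tau u v.
Proof.
move=> u0 uv vT; apply: ler_norm_row => [|i].
  by rewrite mulr_ge0// holder_weight_ge0.
rewrite mxE /B -!mulrA; apply: ler_norm_dot => l.
  by apply: (fo_bdd (sg_fo hs _ _)); rewrite u0 (le_trans uv).
exact: (driver_incr hz).
Qed.

Lemma second_order_le (a : 'I_n -> 'I_n -> R) (M u v : R) :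
  0 <= u -> u <= v -> v <= T -> (forall l q, `|a l q| <= M) ->
  `|\sum_l \sum_q a l q * zeta2 u v q l| <= n%:R * (n%:R * (M * (Z * tau u v ^+ 2))).
Proof.
move=> u0 uv vT aM; rewrite -[X in X%:R * _]card_ord.
apply: ler_norm_sum_cst => l; apply: ler_norm_dot => q //.
exact: (driver_area hz).
Qed.

Lemma increment_le x u v (P : R) : 0 <= u -> u <= v -> v <= T -> tau u v <= 1 ->
  0 <= P -> `|controlled_rem x u v| <= P * tau u v ^+ 2 ->
  `|x v - x u| <= (B + P) * tau u v.
Proof.
move=> u0 uv vT t1 P0 rP; rewrite (controlled_remE x u v) (addrC (x u)) addrK.
rewrite (le_trans (ler_normD _ _))// mulrDl lerD ?first_order_le//.
rewrite (le_trans rP)// ler_wpM2l// expr2 ler_piMr//.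
exact: holder_weight_ge0.
Qed.

Variable c : R.
Hypothesis c0 : 0 <= c.
Hypothesis hc : forall u v : R, u <= v ->
  c * (tau u ((u + v) / 2) ^+ 3 + tau ((u + v) / 2) v ^+ 3) + tau u v ^+ 3
  <= c * tau u v ^+ 3.

(** As 3 beta > 1, the errors made by successive refinements are
    summable: their total is all that separates f from the limit 0 of its dyadic
    sums. *)
Lemma sewing_bound (f : R -> R -> R) (K a b : R) : 0 <= K ->
  (forall u w v, a <= u -> u <= w -> w <= v -> v <= b ->
     `|f u v - f u w - f w v| <= K * tau u v ^+ 3) ->
  (forall u v, a <= u -> u <= v -> v <= b -> forall e, 0 < e ->
    exists N, forall k, (N <= k)%N -> `|dyadic_sum k f u v| <= e) ->
  forall u v, a <= u -> u <= v -> v <= b -> `|f u v| <= c * K * tau u v ^+ 3.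
Proof.
move=> K0 fK f0 u v au uv vb.
have sew k : `|dyadic_sum k f u v - f u v| <= c * K * tau u v ^+ 3.
  apply: (@dyadic_sewing R f (fun u v => tau u v ^+ 3) K c a b) => //.
  - by move=> u' v' ? ? ?; apply: fK => //; lra.
  - by move=> u' v' uv' _; exact: hc.
  - by move=> u' v' _; rewrite exprn_ge0// holder_weight_ge0.
apply/ler_addgt0Pr => e e0; have [N HN] := f0 _ _ au uv vb _ e0.
rewrite -[f u v](subKr (dyadic_sum N f u v)) (le_trans (ler_normB _ _))// addrC.
by rewrite lerD// HN.
Qed.

(** If [controlled_rem] is at most P tau ^ 2, then the defect of [euler_rem] is at
    most (K0 + K1 P) tau ^ 3. *)
Let K0 := n%:R * ((A + A * B ^+ 2) * Z) + n%:R * (n%:R * (A * (1 + B) * Z)).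
Let K1 := n%:R * (A * Z) + n%:R * (n%:R * (A * Z)).

Let K0_ge0 : 0 <= K0.
Proof. by rewrite /K0 addr_ge0// !mulr_ge0// addr_ge0// mulr_ge0// exprn_ge0. Qed.

Let K1_ge0 : 0 <= K1.
Proof. by rewrite /K1 addr_ge0// !mulr_ge0. Qed.

Lemma euler_rem_le x D (P a b : R) : 0 <= a -> b <= T -> b - a <= 1 -> 0 <= P ->
  davie_solution a x D ->
  (forall u v, a <= u -> u <= v -> v <= b -> tau u v <= 1) ->
  (forall u v, a <= u -> u <= v -> v <= b ->
     `|controlled_rem x u v| <= P * tau u v ^+ 2) ->
  forall i u v, a <= u -> u <= v -> v <= b ->
    `|euler_rem x D i u v| <= c * (K0 + K1 * P) * tau u v ^+ 3.
Proof.
move=> a0 bT ba P0 [_ dx] t1 xP i; apply: sewing_bound.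
- by rewrite addr_ge0// mulr_ge0.
- move=> u w v au uw wv vb.
  have [u0 w0 v0] : [/\ 0 <= u, 0 <= w & 0 <= v] by split; lra.
  have [uT wT vT] : [/\ u <= T, w <= T & v <= T] by split; lra.
  have wb : w <= b by lra.
  have aw : a <= w by lra.
  have uv : u <= v by lra.
  have uT' : 0 <= u <= T by rewrite u0.
  have wT' : 0 <= w <= T by rewrite w0.
  rewrite euler_rem_defect//.
  have t0 : 0 <= tau u v by exact: holder_weight_ge0.
  have tuw : tau u w <= tau u v by exact: holder_weight_le.
  have twv : tau w v <= tau u v by exact: holder_weight_le.
  have tuw0 := holder_weight_ge0 beta u w.
  have twv0 := holder_weight_ge0 beta w v.
  have tuw1 := t1 u w au uw wb.
  have tuv1 := t1 u v au uv vb.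
  have wu : w - u <= tau u w ^+ 2 by apply: length_le_holder_weight => //; lra.
  have t2 : tau u w ^+ 2 <= tau u v ^+ 2 by rewrite lerXn2r.
  have t2' : tau w v ^+ 2 <= tau u v ^+ 2 by rewrite lerXn2r.
  have dxuw := increment_le u0 uw wT tuw1 P0 (xP _ _ au uw wb).
  have H1 l : `|gubinelli_rem x i l u w| <= (A + A * P + A * B ^+ 2) * tau u v ^+ 2.
    rewrite gubinelli_rem_split !mulrDl.
    apply: (le_trans (ler_normD _ _)); apply: lerD.
      apply: (le_trans (ler_normD _ _)); apply: lerD.
        rewrite (le_trans (fo_time (sg_fo hs _ _) _ uT' wT'))// ler_wpM2l//.
        by rewrite ger0_norm ?subr_ge0// (le_trans wu).
      rewrite (le_trans (fo_lip (sg_fo hs _ _) _ _ uT'))// -mulrA ler_wpM2l//.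
      rewrite (_ : _ - _ = controlled_rem x u w); last first.
        by rewrite /controlled_rem opprD addrA.
      by rewrite (le_trans (xP _ _ au uw wb))// ler_wpM2l.
    rewrite (le_trans (sg_taylor hs _ _ _ _ uT'))// -mulrA ler_wpM2l//.
    rewrite -exprMn lerXn2r// ?nnegrE ?mulr_ge0//.
    by rewrite (le_trans (first_order_le _ u0 uw wT))// ler_wpM2l.
  have H2 l q : `|fa i l q w (x w) - fa i l q u (x u)| <= A * (1 + B + P) * tau u v.
    rewrite (_ : _ - _ = (fa i l q w (x w) - fa i l q u (x w)) +
      (fa i l q u (x w) - fa i l q u (x u))); last by ring.
    apply: (le_trans (ler_normD _ _)).
    apply: (le_trans (lerD (fo_time (fa_fo hs _ _ _) _ uT' wT') (fo_lip (fa_fo hs _ _ _) _ _ uT'))).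
    rewrite -mulrDr -mulrA ler_wpM2l// -addrA mulrDl mul1r lerD//.
      rewrite ger0_norm ?subr_ge0// (le_trans wu)// (le_trans _ tuw)// expr2.
      by rewrite ler_piMr.
    by rewrite (le_trans dxuw)// ler_wpM2l// addr_ge0.
  apply: (le_trans (ler_normD _ _)).
  have dzwv l := driver_incr hz l w0 wv vT.
  apply: (le_trans (lerD (ler_norm_dot H1 dzwv) (second_order_le w0 wv vT H2))).
  have -> : (K0 + K1 * P) * tau u v ^+ 3 =
    n%:R * ((A + A * P + A * B ^+ 2) * tau u v ^+ 2 * (Z * tau u v)) +
    n%:R * (n%:R * (A * (1 + B + P) * tau u v * (Z * tau u v ^+ 2))).
    by rewrite /K0 /K1; ring.
  have ? : 0 <= A * B ^+ 2 by rewrite mulr_ge0// exprn_ge0.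
  by rewrite lerD// !ler_wpM2l// ?mulr_ge0 ?exprn_ge0 ?addr_ge0 ?mulr_ge0.
- move=> u v au uv vb e e0; apply: dx => //; exact: le_trans bT.
Qed.

Variable M : R.
Hypothesis M0 : 0 <= M.
Definition drift_bounded (s : R) D : Prop := forall i u v, s <= u -> u <= v -> v <= T ->
  `|(D v - D u) 0 i| <= M * (v - u).

Lemma controlled_rem_coord x D i u v : controlled_rem x u v 0 i =
  (D v - D u) 0 i + second_order x i u v + euler_rem x D i u v.
Proof. by rewrite /euler_rem /controlled_rem !mxE; ring. Qed.

Lemma davie_solution_restrict s a x D : s <= a -> davie_solution s x D ->
  davie_solution a x D.
Proof.
move=> sa [[P P0 HP] H]; split.
  by exists P => // u v au; apply: HP; exact: le_trans au.
by move=> i u v au; apply: H; exact: le_trans au.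
Qed.

Let C2 := M + n%:R * (n%:R * (A * Z)) + c * K0.
Let C2_ge0 : 0 <= C2.
Proof. by rewrite /C2 !addr_ge0// !mulr_ge0. Qed.

(** Bounding [controlled_rem] by its drift, its area term and
    its [euler_rem] turns P tau ^ 2 into (C2 + c K1 tau P) tau ^ 2, and the
    smallness of h makes c K1 tau at most 1/2. *)
Lemma controlled_rem_apriori (h : R) : 0 < h -> h <= 1 ->
  (forall u v, u <= v -> v - u <= h -> tau u v <= 1 /\ c * K1 * tau u v <= 2^-1) ->
  forall s x D, 0 <= s -> davie_solution s x D -> drift_bounded s D ->
  forall u v, s <= u -> u <= v -> v <= T -> v - u <= h ->
    `|controlled_rem x u v| <= 2 * C2 * tau u v ^+ 2.
Proof.
move=> h0 h1 hh s x D s0 dx dD.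
have [[P00 P00_ge0 HP0] _] := dx.
suff main (p : R * R) : [/\ s <= p.1, p.1 <= p.2, p.2 <= T & p.2 - p.1 <= h] ->
    `|controlled_rem x p.1 p.2| <= 2 * C2 * tau p.1 p.2 ^+ 2.
  by move=> u v su uv vT vu; exact: (main (u, v)).
apply: (@self_improvement R _
  (fun p => [/\ s <= p.1, p.1 <= p.2, p.2 <= T & p.2 - p.1 <= h])
  (fun p => `|controlled_rem x p.1 p.2|) (fun p => tau p.1 p.2 ^+ 2) C2 P00) => //.
- by move=> q _; rewrite exprn_ge0// holder_weight_ge0.
- by move=> q [? ? ? ?]; exact: HP0.
move=> P P0 HP {p} [u v] /= [su uv vT vu].
have u0 : 0 <= u by exact: le_trans su.
have [tuv1 tK] := hh u v uv vu.
have t0 := holder_weight_ge0 beta u v.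
have t1 u' v' : u <= u' -> u' <= v' -> v' <= v -> tau u' v' <= 1.
  by move=> uu' uv' vv'; have [|//] := hh u' v' uv'; lra.
have vu1 : v - u <= 1 by exact: le_trans h1.
have := @euler_rem_le x D P u v u0 vT vu1 P0 (davie_solution_restrict su dx) t1 _ _ u v
  (lexx _) uv (lexx _).
move=> R3.
have uT : 0 <= u <= T by rewrite u0 (le_trans uv).
apply: ler_norm_row => [|i].
  by apply: mulr_ge0; [apply: addr_ge0 => //; exact: divr_ge0|exact: exprn_ge0].
rewrite (controlled_rem_coord x D).
apply: (le_trans (ler_normD _ _)).
apply: (le_trans (lerD (ler_normD _ _) (R3 _ i))).
  by move=> u' v' uu' uv' vv'; apply: (HP (u', v')); split => /=; lra.
have fau l q : `|fa i l q u (x u)| <= A by exact: (fo_bdd (fa_fo hs _ _ _)).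
apply: (le_trans (lerD (lerD (dD i u v su uv vT) (second_order_le u0 uv vT fau)) (lexx _))).
have H1 : M * (v - u) <= M * tau u v ^+ 2.
  by rewrite ler_wpM2l// length_le_holder_weight.
have t2 : 0 <= tau u v ^+ 2 by rewrite exprn_ge0.
have H2 : (c * K1 * tau u v) * (P * tau u v ^+ 2) <= 2^-1 * (P * tau u v ^+ 2).
  by rewrite ler_wpM2r// mulr_ge0.
have H3 : c * K0 * tau u v ^+ 3 <= c * K0 * tau u v ^+ 2.
  by rewrite ler_wpM2l ?mulr_ge0// exprS ler_piMl.
rewrite /C2; move: H1 H2 H3; set t := tau u v.
have -> : c * (K0 + K1 * P) * t ^+ 3 = c * K0 * t ^+ 3 + (c * K1 * t) * (P * t ^+ 2).
  by ring.
have -> : (M + n%:R * (n%:R * (A * Z)) + c * K0 + P / 2) * t ^+ 2 =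
 M * t ^+ 2 + n%:R * (n%:R * (A * (Z * t ^+ 2))) + c * K0 * t ^+ 2 + 2^-1 * (P * t ^+ 2).
  by ring.
lra.
Qed.

(** * Rough equations: stability *)

(** If two solutions with a priori bound P are at distance at most e and their
    [controlled_rem] differ by at most Q tau ^ 2, then the difference of their
    [euler_rem] has defect at most (K2 P e + K3 P Q) tau ^ 3. *)
Let K2 P := n%:R * ((A + A * (2 * (B + P) * B + (B + P) ^+ 2) + m%:R * (A * P)) * Z)
  + n%:R * (n%:R * (A * (1 + B + (B + P)) * Z)).
Let K3 P := n%:R * ((A * (2 * (B + P)) + m%:R * A) * Z) + n%:R * (n%:R * (A * Z)).

Let K2_ge0 P : 0 <= P -> 0 <= K2 P.
Proof.
move=> P0; have BP : 0 <= B + P by exact: addr_ge0.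
by rewrite /K2; nonneg.
Qed.

Let K3_ge0 P : 0 <= P -> 0 <= K3 P.
Proof.
move=> P0; have BP : 0 <= B + P by exact: addr_ge0.
by rewrite /K3; nonneg.
Qed.

Lemma first_order_dist x y (e u v : R) : 0 <= u -> u <= v -> v <= T ->
  `|x u - y u| <= e -> `|first_order x u v - first_order y u v| <= B * e * tau u v.
Proof.
move=> u0 uv vT xye; have e0 : 0 <= e by exact: le_trans xye.
have t0 := holder_weight_ge0 beta u v.
apply: ler_norm_row => [|i]; first by rewrite !mulr_ge0.
rewrite !mxE -sumrB.
have -> : \sum_l (sg i l u (x u) * dz u v l - sg i l u (y u) * dz u v l) =
  \sum_l (sg i l u (x u) - sg i l u (y u)) * dz u v l.
  by apply: eq_bigr => l _; rewrite mulrBl.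
rewrite (_ : B * e * _ = n%:R * ((A * e) * (Z * tau u v))); last by rewrite /B; ring.
apply: ler_norm_dot => l; last exact: (driver_incr hz).
apply: (le_trans (fo_lip (sg_fo hs _ _) _ _ _)); last by rewrite ler_wpM2l.
by rewrite u0 (le_trans uv).
Qed.

Lemma increment_dist x y (e Q u v : R) : 0 <= u -> u <= v -> v <= T -> tau u v <= 1 ->
  0 <= Q -> `|x u - y u| <= e ->
  `|controlled_rem x u v - controlled_rem y u v| <= Q * tau u v ^+ 2 ->
  `|(x v - x u) - (y v - y u)| <= (B * e + Q) * tau u v.
Proof.
move=> u0 uv vT t1 Q0 xye rQ.
have -> : (x v - x u) - (y v - y u) = (first_order x u v - first_order y u v)
   + (controlled_rem x u v - controlled_rem y u v).
  by rewrite /controlled_rem; apply/rowP => j; rewrite !mxE; ring.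
rewrite (le_trans (ler_normD _ _))// mulrDl lerD//; first exact: first_order_dist.
rewrite (le_trans rQ)// ler_wpM2l// expr2 ler_piMr//.
exact: holder_weight_ge0.
Qed.

Lemma euler_rem_dist x y D E (P Q e a b : R) :
  0 <= a -> b <= T -> b - a <= 1 -> 0 <= P -> 0 <= Q -> 0 <= e ->
  davie_solution a x D -> davie_solution a y E ->
  (forall u v, a <= u -> u <= v -> v <= b -> tau u v <= 1) ->
  (forall u v, a <= u -> u <= v -> v <= b ->
     `|controlled_rem x u v| <= P * tau u v ^+ 2) ->
  (forall u v, a <= u -> u <= v -> v <= b ->
     `|controlled_rem y u v| <= P * tau u v ^+ 2) ->
  (forall u, a <= u -> u <= b -> `|x u - y u| <= e) ->
  (forall u v, a <= u -> u <= v -> v <= b ->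
     `|controlled_rem x u v - controlled_rem y u v| <= Q * tau u v ^+ 2) ->
  forall i u v, a <= u -> u <= v -> v <= b ->
    `|euler_rem x D i u v - euler_rem y E i u v|
    <= c * (K2 P * e + K3 P * Q) * tau u v ^+ 3.
Proof.
move=> a0 bT ba P0 Q0 e0 [_ dx] [_ dy] t1 xP yP xye xyQ i.
apply: (@sewing_bound (fun u v => euler_rem x D i u v - euler_rem y E i u v)).
- by rewrite addr_ge0 ?mulr_ge0 ?K2_ge0 ?K3_ge0.
- move=> u w v au uw wv vb.
  have [u0 w0 v0] : [/\ 0 <= u, 0 <= w & 0 <= v] by split; lra.
  have [uT wT vT] : [/\ u <= T, w <= T & v <= T] by split; lra.
  have wb : w <= b by lra.
  have aw : a <= w by lra.
  have uv : u <= v by lra.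
  have ub : u <= b by lra.
  have uT' : 0 <= u <= T by rewrite u0.
  have wT' : 0 <= w <= T by rewrite w0.
  set t := tau u v.
  have t0 : 0 <= t by exact: holder_weight_ge0.
  have tuw : tau u w <= t by exact: holder_weight_le.
  have twv : tau w v <= t by exact: holder_weight_le.
  have tuw0 := holder_weight_ge0 beta u w.
  have twv0 := holder_weight_ge0 beta w v.
  have tuw1 := t1 u w au uw wb.
  have tuv1 : t <= 1 by exact: t1.
  have wut : w - u <= t ^+ 2.
    apply: (@le_trans _ _ (tau u w ^+ 2)); last by rewrite lerXn2r.
    by apply: length_le_holder_weight => //; lra.
  have t20 : 0 <= t ^+ 2 by exact: exprn_ge0.
  have t2t : t ^+ 2 <= t by rewrite expr2 ler_piMr.
  have t2 : tau u w ^+ 2 <= t ^+ 2 by rewrite lerXn2r.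
  have t2' : tau w v ^+ 2 <= t ^+ 2 by rewrite lerXn2r.
  have dt : `|w - u| <= t ^+ 2 by rewrite ger0_norm ?subr_ge0.
  have BP : 0 <= B + P by exact: addr_ge0.
  have BeQ : 0 <= B * e + Q by rewrite addr_ge0// mulr_ge0.
  have dx_le : `|x w - x u| <= (B + P) * t.
    rewrite (le_trans (increment_le u0 uw wT tuw1 P0 (xP _ _ au uw wb)))//.
    by rewrite ler_wpM2l.
  have dy_le : `|y w - y u| <= (B + P) * t.
    rewrite (le_trans (increment_le u0 uw wT tuw1 P0 (yP _ _ au uw wb)))//.
    by rewrite ler_wpM2l.
  have dxy_le : `|(x w - x u) - (y w - y u)| <= (B * e + Q) * t.
    rewrite (le_trans (increment_dist u0 uw wT tuw1 Q0 (xye _ au ub)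
      (xyQ _ _ au uw wb)))//.
    by rewrite ler_wpM2l.
  have xyu := xye _ au ub; have xyw := xye _ aw wb.
  have H1 l : `|gubinelli_rem x i l u w - gubinelli_rem y i l u w| <=
      ((A + A * (2 * (B + P) * B + (B + P) ^+ 2) + m%:R * (A * P)) * e +
       (A * (2 * (B + P)) + m%:R * A) * Q) * t ^+ 2.
    rewrite !gubinelli_rem_taylor.
    set sx := \sum_j _; set sy := \sum_j _.
    set rx := taylor_rem _ _ _ _ _; set ry := taylor_rem _ _ _ _ _.
    rewrite (_ : _ - _ = ((sg i l w (x w) - sg i l u (x w)) -
      (sg i l w (y w) - sg i l u (y w))) + (rx - ry) + (sx - sy)); last by ring.
    have L1 : `|(sg i l w (x w) - sg i l u (x w)) -
      (sg i l w (y w) - sg i l u (y w))| <= A * t ^+ 2 * e.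
      rewrite (le_trans (fo_mixed (sg_fo hs _ _) _ _ uT' wT'))//.
      by rewrite ler_pM ?mulr_ge0// ler_wpM2l.
    have L2 : `|rx - ry| <= A * (((B + P) * t + (B + P) * t) * ((B * e + Q) * t)
        + ((B + P) * t) ^+ 2 * e).
      rewrite (le_trans (sg_taylor_dist hs _ _ _ _ _ _ uT'))// ler_wpM2l//.
      rewrite lerD//; first by rewrite ler_pM ?addr_ge0 ?lerD.
      by rewrite ler_pM ?exprn_ge0// lerXn2r ?nnegrE ?mulr_ge0.
    have L3 : `|sx - sy| <= m%:R * ((A * e) * (P * t ^+ 2)) + m%:R * (A * (Q * t ^+ 2)).
      have -> : sx - sy = \sum_j (dsg i l j u (x u) - dsg i l j u (y u)) *
          controlled_rem x u w 0 j +
          \sum_j dsg i l j u (y u) * (controlled_rem x u w - controlled_rem y u w) 0 j.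
        rewrite -big_split -sumrB/=; apply: eq_bigr => j _.
        have -> : (controlled_rem x u w - controlled_rem y u w) 0 j =
          controlled_rem x u w 0 j - controlled_rem y u w 0 j by rewrite !mxE.
        ring.
      rewrite (le_trans (ler_normD _ _))// lerD//; apply: ler_norm_dot => j.
      + by rewrite (le_trans (fo_lip (dsg_fo hs _ _ _) _ _ uT'))// ler_wpM2l.
      + rewrite (le_trans (ler_norm_coord _ _))// (le_trans (xP _ _ au uw wb))//.
        by rewrite ler_wpM2l.
      + exact: (fo_bdd (dsg_fo hs _ _ _)).
      + rewrite (le_trans (ler_norm_coord _ _))// (le_trans (xyQ _ _ au uw wb))//.
        by rewrite ler_wpM2l.
    rewrite (le_trans (ler_normD _ _))//.
    rewrite (le_trans (lerD (le_trans (ler_normD _ _) (lerD L1 L2)) L3))//.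
    rewrite le_eqVlt; apply/orP; left; apply/eqP; ring.
  have H2 l q : `|(fa i l q w (x w) - fa i l q u (x u)) -
      (fa i l q w (y w) - fa i l q u (y u))| <=
      (A * (1 + B + (B + P)) * e + A * Q) * t.
    rewrite (_ : _ - _ = ((fa i l q w (x w) - fa i l q u (x w)) -
      (fa i l q w (y w) - fa i l q u (y w))) +
      ((fa i l q u (x u + (x w - x u)) - fa i l q u (x u)) -
       (fa i l q u (y u + (y w - y u)) - fa i l q u (y u)))); last first.
      by rewrite (addrC (x u)) (addrC (y u)) !subrK; ring.
    rewrite (le_trans (ler_normD _ _))//.
    have L1 : A * `|w - u| * `|x w - y w| <= A * t * e.
      by rewrite ler_pM ?mulr_ge0// ler_wpM2l// (le_trans dt).
    have L2 : A * (`|(x w - x u) - (y w - y u)| + `|y w - y u| * `|x u - y u|) <=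
        A * ((B * e + Q) * t + (B + P) * t * e).
      by rewrite ler_wpM2l// lerD// ler_pM.
    rewrite (le_trans (lerD (fo_mixed (fa_fo hs _ _ _) _ _ uT' wT')
       (fa_four_point hs _ _ _ _ _ _ _ uT')))//.
    rewrite (le_trans (lerD L1 L2))//.
    rewrite le_eqVlt; apply/orP; left; apply/eqP; ring.
  rewrite (_ : _ - _ - _ =
    (euler_rem x D i u v - euler_rem x D i u w - euler_rem x D i w v) -
    (euler_rem y E i u v - euler_rem y E i u w - euler_rem y E i w v)); last by ring.
  rewrite !euler_rem_defect//.
  rewrite (_ : _ - _ = \sum_l (gubinelli_rem x i l u w - gubinelli_rem y i l u w)
    * dz w v l + \sum_l \sum_q ((fa i l q w (x w) - fa i l q u (x u)) -
      (fa i l q w (y w) - fa i l q u (y u))) * zeta2 w v q l); last first.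
    rewrite opprD addrACA -!sumrB; congr (_ + _); apply: eq_bigr => l _.
      by rewrite -mulrBl.
    by rewrite -sumrB; apply: eq_bigr => q _; rewrite -mulrBl.
  rewrite (le_trans (ler_normD _ _))//.
  have dzwv l := driver_incr hz l w0 wv vT.
  apply: (le_trans (lerD (ler_norm_dot H1 dzwv) (second_order_le w0 wv vT H2))).
  set G1 := (_ * e + _ * Q : R); set G2 := (_ * e + _ * Q : R).
  have G10 : 0 <= G1 by rewrite /G1; nonneg.
  have G20 : 0 <= G2 by rewrite /G2; nonneg.
  have -> : (K2 P * e + K3 P * Q) * t ^+ 3 =
    n%:R * (G1 * t ^+ 2 * (Z * t)) + n%:R * (n%:R * (G2 * t * (Z * t ^+ 2))).
    by rewrite /K2 /K3 /G1 /G2; ring.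
  by rewrite lerD// !ler_wpM2l// ?mulr_ge0.
- move=> u v au uv vb r r0.
  have r2 : 0 < r / 2 by rewrite divr_gt0.
  have [N1 H1] := dx i u v au uv (le_trans vb bT) _ r2.
  have [N2 H2] := dy i u v au uv (le_trans vb bT) _ r2.
  exists (maxn N1 N2) => k; rewrite geq_max => /andP[k1 k2].
  rewrite dyadic_sumB (splitr r) (le_trans (ler_normB _ _))// lerD//.
    exact: H1.
  exact: H2.
Qed.

(** The distance of the drifts over [u, v] only depends on the
    distance of the paths over [u, v]: two solutions with the same control. *)
Definition drift_lipschitz (M1 s : R) x y D E : Prop :=
  forall i u v e, s <= u -> u <= v -> v <= T -> 0 <= e ->
    (forall t, u <= t -> t <= v -> `|x t - y t| <= e) ->
    `|((D v - D u) - (E v - E u)) 0 i| <= M1 * e * (v - u).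

Variable M1 : R.
Hypothesis M10 : 0 <= M1.
Let Pu := 2 * C2.
Let Pu0 : 0 <= Pu. Proof. exact: mulr_ge0. Qed.
Let C3 := M1 + n%:R * (n%:R * (A * Z)) + c * K2 Pu.
Let C30 : 0 <= C3.
Proof. by have := K2_ge0 Pu0; rewrite /C3 => ?; nonneg. Qed.

(** Once tau is at most 1, the next three conditions close the a
    priori bound, the bound on the difference of two [controlled_rem], and the
    bound on the distance of two solutions. *)
Definition small_step (h : R) : Prop := forall u v : R, u <= v -> v - u <= h ->
  [/\ tau u v <= 1, c * K1 * tau u v <= 2^-1, c * K3 Pu * tau u v <= 2^-1 &
    (B + 2 * C3) * tau u v <= 2^-1].

Lemma small_step_exists : exists h, [/\ 0 < h, h <= 1 & small_step h].
Proof.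
have K30 := K3_ge0 Pu0.
(* One q dominates the factors of tau in all four conditions. *)
pose q := 1 + c * K1 + c * K3 Pu + (B + 2 * C3).
have [cK1 cK3] : 0 <= c * K1 /\ 0 <= c * K3 Pu by split; exact: mulr_ge0.
have BC : 0 <= B + 2 * C3 by apply: addr_ge0 => //; exact: mulr_ge0.
have q1 : 1 <= q by rewrite /q; lra.
have q0 : 0 < q by exact: lt_le_trans q1.
have eta0 : 0 < (2 * q)^-1 by rewrite invr_gt0 mulr_gt0.
have [h [h0 h1 hP]] := holder_weight_small hbeta eta0.
exists h; split => // u v uv vu; have := hP u v uv vu.
have t0 := holder_weight_ge0 beta u v.
have qE : q * (2 * q)^-1 = 2^-1 by field; rewrite gt_eqF.
move=> te.
have qt (r : R) : r <= q -> r * tau u v <= 2^-1.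
  move=> rq; rewrite -qE; apply: (@le_trans _ _ (q * tau u v)).
    by rewrite ler_wpM2r.
  by rewrite ler_wpM2l// ltW.
split; try (apply: qt; rewrite /q; lra).
by rewrite -[leLHS]mul1r (le_trans (qt _ q1))//; lra.
Qed.

Variable h : R.
Hypotheses (h0 : 0 < h) (h1 : h <= 1) (hh : small_step h).

Lemma controlled_rem_uniform s x D : 0 <= s -> davie_solution s x D ->
  drift_bounded s D -> forall u v, s <= u -> u <= v -> v <= T -> v - u <= h ->
  `|controlled_rem x u v| <= Pu * tau u v ^+ 2.
Proof.
apply: controlled_rem_apriori => // u v uv vu.
by have [? ? _ _] := hh uv vu.
Qed.

Lemma increment_uniform : exists2 K, 0 <= K &
  forall s x D, 0 <= s -> davie_solution s x D -> drift_bounded s D ->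
  forall u v S S2, s <= u -> u <= v -> v <= T -> v - u <= h ->
  (forall l, `|dz u v l| <= S) -> (forall q l, `|zeta2 u v q l| <= S2) ->
  0 <= S -> 0 <= S2 ->
  `|x v - x u| <= M * (v - u) + n%:R * (A * S) + n%:R * (n%:R * (A * S2))
     + K * tau u v ^+ 3.
Proof.
exists (c * (K0 + K1 * Pu)).
  by apply: mulr_ge0 => //; apply: addr_ge0 => //; exact: mulr_ge0.
move=> s x D s0 dx dD u v S S2 su uv vT vu zS zS2 S0 S20.
have u0 : 0 <= u by exact: le_trans su.
have uT : 0 <= u <= T by rewrite u0 (le_trans uv).
have t0 := holder_weight_ge0 beta u v.
apply: ler_norm_row => [|i].
  have vu0 : 0 <= v - u by rewrite subr_ge0.
  by nonneg.
have -> : (x v - x u) 0 i = (D v - D u) 0 i + first_order x u v 0 i +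
    second_order x i u v + euler_rem x D i u v.
  by rewrite /euler_rem; ring.
rewrite (le_trans (ler_normD _ _))// lerD//; last first.
  apply: (@euler_rem_le x D Pu u v) => //.
  - exact: le_trans h1.
  - exact: davie_solution_restrict su dx.
  - by move=> u' v' uu' uv' vv'; have [|//] := hh uv'; lra.
  - move=> u' v' uu' uv' vv'; apply: (controlled_rem_uniform s0 dx dD); lra.
rewrite (le_trans (ler_normD _ _))// lerD//; last first.
  rewrite -[X in X%:R * _]card_ord; apply: ler_norm_sum_cst => l.
  by apply: ler_norm_dot => q //; exact: (fo_bdd (fa_fo hs _ _ _)).
rewrite (le_trans (ler_normD _ _))// lerD//; first exact: dD.
by rewrite mxE; apply: ler_norm_dot => // l; exact: (fo_bdd (sg_fo hs _ _)).
Qed.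

Section TwoSolutions.
Variables (s : R) (x y D E : R -> 'rV[R]_m).
Hypotheses (s0 : 0 <= s) (dx : davie_solution s x D) (dy : davie_solution s y E).
Hypotheses (bD : drift_bounded s D) (bE : drift_bounded s E).
Hypothesis DE : drift_lipschitz M1 s x y D E.

Let xP := controlled_rem_uniform s0 dx bD.
Let yP := controlled_rem_uniform s0 dy bE.

(** The improvement of Q is linear, like that of P in
    [controlled_rem_apriori], with the distance e of the solutions as source. *)
Lemma controlled_rem_dist (a b e : R) : s <= a -> b <= T -> b - a <= h -> 0 <= e ->
  (forall t, a <= t -> t <= b -> `|x t - y t| <= e) ->
  forall u v, a <= u -> u <= v -> v <= b ->
    `|controlled_rem x u v - controlled_rem y u v| <= 2 * (C3 * e) * tau u v ^+ 2.
Proof.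
move=> sa bT ba e0 xye.
suff main (p : R * R) : [/\ a <= p.1, p.1 <= p.2 & p.2 <= b] ->
    `|controlled_rem x p.1 p.2 - controlled_rem y p.1 p.2|
    <= 2 * (C3 * e) * tau p.1 p.2 ^+ 2.
  by move=> u v au uv vb; exact: (main (u, v)).
apply: (@self_improvement R _ (fun p => [/\ a <= p.1, p.1 <= p.2 & p.2 <= b])
  (fun p => `|controlled_rem x p.1 p.2 - controlled_rem y p.1 p.2|)
  (fun p => tau p.1 p.2 ^+ 2) (C3 * e) (Pu + Pu)).
- by move=> q _; rewrite exprn_ge0// holder_weight_ge0.
- exact: mulr_ge0.
- exact: addr_ge0.
- move=> [u v] /= [au uv vb]; rewrite (le_trans (ler_normB _ _))// mulrDl.
  by rewrite lerD//; [apply: (xP (u := u))|apply: (yP (u := u))] => //; lra.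
move=> Q Q0 HQ {p} [u v] /= [au uv vb].
have u0 : 0 <= u := le_trans s0 (le_trans sa au).
have su : s <= u by lra.
have vT : v <= T by lra.
have vu : v - u <= h by lra.
have vu1 : v - u <= 1 := le_trans vu h1.
have [tuv1 _ tK _] := hh uv vu.
have t0 := holder_weight_ge0 beta u v.
have K20 := K2_ge0 Pu0.
have R3 i : `|euler_rem x D i u v - euler_rem y E i u v|
    <= c * (K2 Pu * e + K3 Pu * Q) * tau u v ^+ 3.
  apply: (@euler_rem_dist x y D E Pu Q e u v) => //.
  - exact: davie_solution_restrict su dx.
  - exact: davie_solution_restrict su dy.
  - by move=> u' v' uu' uv' vv'; have [|//] := hh uv'; lra.
  - by move=> u' v' uu' uv' vv'; apply: xP; lra.
  - by move=> u' v' uu' uv' vv'; apply: yP; lra.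
  - by move=> t ut tv; apply: xye; lra.
  - by move=> u' v' uu' uv' vv'; apply: (HQ (u', v')); split => /=; lra.
have uT : 0 <= u <= T by rewrite u0 (le_trans uv).
have t2 : 0 <= tau u v ^+ 2 by rewrite exprn_ge0.
apply: ler_norm_row => [|i].
  apply: mulr_ge0 => //; apply: addr_ge0; first exact: mulr_ge0.
  exact: divr_ge0.
have -> : (controlled_rem x u v - controlled_rem y u v) 0 i =
    ((D v - D u) - (E v - E u)) 0 i + (second_order x i u v - second_order y i u v)
    + (euler_rem x D i u v - euler_rem y E i u v).
  rewrite mxE [in X in _ + X]mxE (controlled_rem_coord x D) (controlled_rem_coord y E).
  by rewrite [in RHS]mxE [in X in _ = _ + X + _ + _]mxE; ring.
rewrite (le_trans (ler_normD _ _))//.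
apply: (le_trans (lerD (ler_normD _ _) (R3 i))).
have L1 : `|((D v - D u) - (E v - E u)) 0 i| <= M1 * e * tau u v ^+ 2.
  rewrite (le_trans (DE i su uv vT e0 _))//.
    by move=> t ut tv; apply: xye; lra.
  by rewrite ler_wpM2l ?mulr_ge0// length_le_holder_weight.
have L2 : `|second_order x i u v - second_order y i u v| <=
    n%:R * (n%:R * (A * e * (Z * tau u v ^+ 2))).
  rewrite /second_order -sumrB.
  rewrite (_ : \sum_l _ = \sum_l \sum_q (fa i l q u (x u) - fa i l q u (y u)) *
    zeta2 u v q l); last first.
    by apply: eq_bigr => l _; rewrite -sumrB; apply: eq_bigr => q _; rewrite mulrBl.
  apply: second_order_le => // l q.
  rewrite (le_trans (fo_lip (fa_fo hs _ _ _) _ _ uT))// ler_wpM2l// xye//; lra.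
apply: (le_trans (lerD (lerD L1 L2) (lexx _))).
have L3 : (c * K3 Pu * tau u v) * (Q * tau u v ^+ 2) <= 2^-1 * (Q * tau u v ^+ 2).
  by rewrite ler_wpM2r// mulr_ge0.
have L4 : c * K2 Pu * e * tau u v ^+ 3 <= c * K2 Pu * e * tau u v ^+ 2.
  rewrite ler_wpM2l//; first by apply: mulr_ge0 => //; exact: mulr_ge0.
  by rewrite exprS ler_piMl.
rewrite /C3; move: L3 L4; set t := tau u v.
have -> : c * (K2 Pu * e + K3 Pu * Q) * t ^+ 3 =
  c * K2 Pu * e * t ^+ 3 + (c * K3 Pu * t) * (Q * t ^+ 2) by ring.
have -> : ((M1 + n%:R * (n%:R * (A * Z)) + c * K2 Pu) * e + Q / 2) * t ^+ 2 =
  M1 * e * t ^+ 2 + n%:R * (n%:R * (A * e * (Z * t ^+ 2))) + c * K2 Pu * e * t ^+ 2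
  + 2^-1 * (Q * t ^+ 2) by ring.
lra.
Qed.

(** By [controlled_rem_dist] a bound e on the distance improves
    to the initial distance plus e / 2. *)
Lemma short_time_stability a b : s <= a -> b <= T -> b - a <= h ->
  forall t, a <= t -> t <= b -> `|x t - y t| <= 2 * `|x a - y a|.
Proof.
move=> sa bT ba t aat tb.
have BP : 0 <= B + Pu by exact: addr_ge0.
rewrite -[leRHS]mulr1.
(* The a priori Hoelder bounds on x and y supply the initial bound. *)
apply: (@self_improvement R R (fun t => a <= t <= b) (fun t => `|x t - y t|)
  (fun=> 1) `|x a - y a| (`|x a - y a| + 2 * (B + Pu))) => //.
- by rewrite addr_ge0// mulr_ge0.
- move=> r /andP[ar rb]; rewrite mulr1.
  have [tar1 _ _ _] := hh ar (le_trans (lerB rb (lexx a)) ba).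
  have t0 := holder_weight_ge0 beta a r.
  rewrite (_ : x r - y r = (x a - y a) + ((x r - x a) - (y r - y a))); last first.
    by apply/rowP => j; rewrite !mxE; ring.
  have rT : r <= T by lra.
  have a0 : 0 <= a := le_trans s0 sa.
  have rh : r - a <= h by lra.
  rewrite (le_trans (ler_normD _ _))// lerD2l (le_trans (ler_normB _ _))//.
  rewrite mulr_natl mulr2n lerD//.
    rewrite (le_trans (increment_le a0 ar rT tar1 Pu0 (xP sa ar rT rh)))//.
    by rewrite ler_piMr.
  rewrite (le_trans (increment_le a0 ar rT tar1 Pu0 (yP sa ar rT rh)))//.
  by rewrite ler_piMr.
- move=> e e0 He r /andP[ar rb].
  have rT : r <= T by lra.
  have a0 : 0 <= a := le_trans s0 sa.
  have rh : r - a <= h by lra.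
  have [tar1 _ _ tB] := hh ar rh.
  have C3e : 0 <= 2 * (C3 * e) by apply: mulr_ge0 => //; exact: mulr_ge0.
  have xye q : a <= q -> q <= b -> `|x q - y q| <= e.
    by move=> aq qb; rewrite -[e]mulr1 He// aq.
  have cr := controlled_rem_dist sa bT ba e0 xye (lexx a) ar rb.
  have := increment_dist a0 ar rT tar1 C3e (xye a (lexx a) (le_trans ar rb)) cr.
  rewrite (_ : x r - y r = (x a - y a) + ((x r - x a) - (y r - y a))); last first.
    by apply/rowP => j; rewrite !mxE; ring.
  move=> inc; rewrite mulr1 (le_trans (ler_normD _ _))// lerD2l (le_trans inc)//.
  rewrite (_ : _ * tau a r = e * ((B + 2 * C3) * tau a r)); last by ring.
  by rewrite ler_wpM2l.
- by rewrite aat.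
Qed.

Lemma stability_iterate k t : s <= t -> t <= T -> t <= s + k%:R * h ->
  `|x t - y t| <= 2 ^+ k * `|x s - y s|.
Proof.
elim: k t => [|k IH] t st tT.
  rewrite mul0r addr0 => ts; have -> : t = s by apply/eqP; rewrite eq_le ts.
  by rewrite mul1r.
rewrite -natr1 mulrDl mul1r => tk.
have kh : 0 <= k%:R * h by rewrite mulr_ge0// ltW.
(* Beyond s + k h, restart from that point for a time at most h. *)
have [tk'|tk'] := leP t (s + k%:R * h).
  rewrite (le_trans (IH _ _ _ tk'))// ler_wpM2r// ler_eXn2l ?ltr1n//.
set a := s + k%:R * h in tk'.
have sa : s <= a by rewrite /a lerDl.
have aat := ltW tk'.
have ta : t - a <= h by rewrite /a; lra.
rewrite (le_trans (short_time_stability sa tT ta aat (lexx _)))//.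
rewrite exprS -mulrA ler_wpM2l// IH//; exact: le_trans tT.
Qed.

End TwoSolutions.

Lemma rough_equation_stability : exists2 C, 0 <= C & forall s x y D E,
  0 <= s -> davie_solution s x D -> davie_solution s y E ->
  drift_bounded s D -> drift_bounded s E -> drift_lipschitz M1 s x y D E ->
  forall t, s <= t -> t <= T -> `|x t - y t| <= C * `|x s - y s|.
Proof.
pose N := (Num.trunc (`|T| / h)).+1.
exists (2 ^+ N); first exact: exprn_ge0.
move=> s x y D E s0 dx dy bD bE DE t st tT.
apply: (stability_iterate s0 dx dy bD bE DE) => //.
have : `|T| / h < N%:R by exact: truncnS_gt.
rewrite ltr_pdivrMr// => /ltW; have := ler_norm T; lra.
Qed.

End RoughEquation.

Lemma rough_equation_estimates (R : realType) (m n : nat) (T beta Z A M M1 : R)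
    (zeta : R -> 'rV[R]_n) (zeta2 : R -> R -> 'M[R]_n)
    (sg : 'I_m -> 'I_n -> R -> 'rV[R]_m -> R)
    (dsg : 'I_m -> 'I_n -> 'I_m -> R -> 'rV[R]_m -> R) :
  3^-1 < beta <= 2^-1 -> 0 <= Z -> 0 <= A -> 0 <= M -> 0 <= M1 ->
  rough_driver T beta Z zeta zeta2 -> field_bounds T A sg dsg ->
  exists h C, [/\ 0 < h, h <= 1, 0 <= C,
    forall s x y D E, 0 <= s -> davie_solution T beta zeta zeta2 sg dsg s x D ->
      davie_solution T beta zeta zeta2 sg dsg s y E ->
      drift_bounded T M s D -> drift_bounded T M s E ->
      drift_lipschitz T M1 s x y D E ->
      forall t, s <= t -> t <= T -> `|x t - y t| <= C * `|x s - y s| &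
    forall s x D, 0 <= s -> davie_solution T beta zeta zeta2 sg dsg s x D ->
      drift_bounded T M s D ->
      forall u v S S2, s <= u -> u <= v -> v <= T -> v - u <= h ->
      (forall l, `|(zeta v - zeta u) 0 l| <= S) ->
      (forall q l, `|zeta2 u v q l| <= S2) -> 0 <= S -> 0 <= S2 ->
      `|x v - x u| <= C * ((v - u) + S + S2 + holder_weight beta u v ^+ 3)].
Proof.
move=> hbeta Z0 A0 M0 M10 hz hs.
have [c c0 hc] := holder_weight_sewing hbeta.
have [h [h0 h1 hh]] := small_step_exists m n hbeta Z0 A0 c0 M0 M10.
have [C C0 stab] := rough_equation_stability hbeta Z0 A0 hz hs c0 hc M0 M10 h0 h1 hh.
have [K K00 incr] := increment_uniform hbeta Z0 A0 hz hs c0 hc M0 h0 h1 hh.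
exists h, (C + (M + n%:R * A + n%:R * (n%:R * A) + K)).
have nA : 0 <= n%:R * A by exact: mulr_ge0.
have nnA : 0 <= n%:R * (n%:R * A) by exact: mulr_ge0.
split => //; first by rewrite !addr_ge0.
- move=> s x y D E s0 dx dy bD bE DE t st tT.
  rewrite (le_trans (stab _ _ _ _ _ s0 dx dy bD bE DE t st tT))// ler_wpM2r//.
  by rewrite lerDl !addr_ge0.
move=> s x D s0 dx bD u v S S2 su uv vT vu zS zS2 S0 S20.
rewrite (le_trans (incr _ _ _ s0 dx bD u v S S2 su uv vT vu zS zS2 S0 S20))//.
have vu0 : 0 <= v - u by rewrite subr_ge0.
have t0 : 0 <= holder_weight beta u v ^+ 3.
  by rewrite exprn_ge0// holder_weight_ge0.
set t := holder_weight beta u v ^+ 3 in t0 *.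
rewrite [leRHS](_ : _ = M * (v - u) + n%:R * (A * S) + n%:R * (n%:R * (A * S2)) +
  K * t + (C * (v - u + S + S2 + t) + M * (S + S2 + t) +
  n%:R * A * (v - u + S2 + t) + n%:R * (n%:R * A) * (v - u + S + t) +
  K * (v - u + S + S2))); last by ring.
by rewrite lerDl; nonneg.
Qed.

(** * Coefficients and drift of the controlled equation *)

Section PowerComparison.
Context (R : realType).

(** Write r ^ q as r ^ (q - p) r ^ p and bound the first factor at
    T. *)
Lemma powR_le_exponent (r T p q : R) : 0 <= r -> r <= T -> 0 < p -> p <= q ->
  r `^ q <= T `^ (q - p) * r `^ p.
Proof.
move=> r0 rT p0 pq; move: r0; rewrite le_eqVlt => /predU1P[<-|r0].
  rewrite [leLHS]powR0 ?mulr_ge0 ?powR_ge0//.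
  by rewrite gt_eqF// (lt_le_trans p0).
have -> : r `^ q = r `^ (q - p) * r `^ p.
  by rewrite -powRD ?subrK// (gt_eqF r0) implybT.
rewrite ler_wpM2r ?powR_ge0//.
by apply: ge0_ler_powR; rewrite ?nnegrE ?subr_ge0// ?ltW// (lt_le_trans r0).
Qed.

Lemma powR_le_exponent1 (r p q : R) : 0 <= r -> r <= 1 -> 0 < p -> p <= q ->
  r `^ q <= r `^ p.
Proof.
by move=> r0 r1 p0 pq; have := powR_le_exponent r0 r1 p0 pq; rewrite powR1 mul1r.
Qed.

End PowerComparison.

Section CoefficientBounds.
Context (R : realType) (m n : nat) (T : R).

Lemma first_order_boundsW (A A' : R) (f : R -> 'rV[R]_m -> R) : A <= A' ->
  first_order_bounds T A f -> first_order_bounds T A' f.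
Proof.
move=> AA [H1 H2 H3 H4]; split.
- by move=> t x tT; rewrite (le_trans (H1 _ _ _)).
- by move=> s t x sT tT; rewrite (le_trans (H2 _ _ _ _ _))// ler_wpM2r.
- by move=> t x y tT; rewrite (le_trans (H3 _ _ _ _))// ler_wpM2r.
- by move=> s t x y sT tT; rewrite (le_trans (H4 _ _ _ _ _ _))// -!mulrA ler_wpM2r// mulr_ge0.
Qed.

Lemma smooth_first_order_bounds (f : R -> 'rV[R]_m -> R) : smooth T 1 f ->
  exists A, first_order_bounds T A f.
Proof.
move=> fS; have [M [B L]] := smooth_time_lipschitz fS.
have [C1 C10 L1] := smooth_lipschitz fS.
have [C2 C20 L2] := smooth_mixed fS.
exists (`|M| + C1 + C2); split.
- move=> t x tT; rewrite (le_trans (B _ _ tT))// (le_trans (ler_norm M))//.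
  by rewrite -addrA lerDl addr_ge0.
- move=> s t x sT tT; rewrite (le_trans (L _ _ _ sT tT))// ler_wpM2r//.
  by rewrite (le_trans (ler_norm M))// -addrA lerDl addr_ge0.
- move=> t x y tT; rewrite (le_trans (L1 _ _ _ tT))// ler_wpM2r//.
  by rewrite addrAC lerDr addr_ge0.
- move=> s t x y sT tT; rewrite (le_trans (L2 _ _ _ _ sT tT))// !ler_wpM2r//.
  by rewrite lerDr addr_ge0.
Qed.

Lemma Cb_field_bounds (sigma : R -> 'rV[R]_m -> 'M[R]_(m, n)) :
  (forall i j, Cb 1 3 T (fun t x => sigma t x i j)) ->
  exists A dsg, [/\ 0 <= A,
    field_bounds T A (fun i l t x => sigma t x i l) dsg &
    forall i l j t x, 0 <= t <= T ->
      'D_(delta_mx 0 j) (fun z => sigma t z i l) x = dsg i l j t x].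
Proof.
move=> hC.
have sgS i l : smooth T 3 (fun t x => sigma t x i l) by have [] := Cb_smooth (hC i l).
have dsg_ex (p : 'I_m * 'I_n) : exists df : 'I_m -> R -> 'rV[R]_m -> R,
    [/\ partials T (fun t x => sigma t x p.1 p.2) df,
      forall j, smooth T 2 (df j) &
      forall j t x, 0 <= t <= T ->
        'D_(delta_mx 0 j) (fun z => sigma t z p.1 p.2) x = df j t x].
  by case: p => i l; have [_ [df dP [dS dE]]] := Cb_smooth (hC i l); exists df.
have [dsg dsgP] := choice dsg_ex.
pose ds i l := dsg (i, l).
have dsS i l j : smooth T 2 (ds i l j) by have [_ + _] := dsgP (i, l); apply.
have faS i l q : smooth T 2 (field_along (fun i l t x => sigma t x i l) ds i l q).
  apply: smooth_sum => j; apply: smoothM; first exact: dsS.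
  by apply: smoothW; exact: sgS.
have [A1 A10 HA1] : exists2 A, 0 <= A & forall p : 'I_m * 'I_n,
    first_order_bounds T A (fun t x => sigma t x p.1 p.2).
  apply: finite_bound => [p a b ab|p]; first exact: first_order_boundsW.
  by apply: smooth_first_order_bounds; do 2!apply: smoothW; exact: sgS.
have [A2 A20 HA2] : exists2 A, 0 <= A & forall p : 'I_m * 'I_n * 'I_m,
    first_order_bounds T A (ds p.1.1 p.1.2 p.2).
  apply: finite_bound => [p a b ab|p]; first exact: first_order_boundsW.
  by apply: smooth_first_order_bounds; apply: smoothW; exact: dsS.
have [A3 A30 HA3] : exists2 A, 0 <= A & forall p : 'I_m * 'I_n * 'I_n,
    first_order_bounds T A (field_along (fun i l t x => sigma t x i l) ds p.1.1 p.1.2 p.2).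
  apply: finite_bound => [p a b ab|p]; first exact: first_order_boundsW.
  by apply: smooth_first_order_bounds; apply: smoothW; exact: faS.
have [A4 A40 HA4] : exists2 A, 0 <= A & forall (p : 'I_m * 'I_n) t x h, 0 <= t <= T ->
    `|taylor_rem (fun t x => sigma t x p.1 p.2) (ds p.1 p.2) t x h| <= A * `|h| ^+ 2.
  apply: finite_bound => [p a b ab H t x h tT|[i l]].
    by rewrite (le_trans (H _ _ _ tT))// ler_wpM2r// exprn_ge0.
  have [dP _ _] := dsgP (i, l).
  have [C _ H] := taylor_rem_le dP (fun j => smoothW (dsS i l j)).
  by exists C.
have [A5 A50 HA5] : exists2 A, 0 <= A & forall (p : 'I_m * 'I_n) t x y h k,
    0 <= t <= T ->
    `|taylor_rem (fun t x => sigma t x p.1 p.2) (ds p.1 p.2) t x h -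
      taylor_rem (fun t x => sigma t x p.1 p.2) (ds p.1 p.2) t y k|
    <= A * ((`|h| + `|k|) * `|h - k| + `|k| ^+ 2 * `|x - y|).
  apply: finite_bound => [p a b ab H t x y h k tT|[i l]].
    by rewrite (le_trans (H _ _ _ _ _ tT))// ler_wpM2r//; nonneg.
  have [dP _ _] := dsgP (i, l).
  by have [C _ H] := taylor_rem_dist dP (dsS i l); exists C.
have [A6 A60 HA6] : exists2 A, 0 <= A & forall (p : 'I_m * 'I_n * 'I_n) t x y h k,
    0 <= t <= T -> let fa := field_along (fun i l t x => sigma t x i l) ds in
    `|(fa p.1.1 p.1.2 p.2 t (x + h) - fa p.1.1 p.1.2 p.2 t x) -
      (fa p.1.1 p.1.2 p.2 t (y + k) - fa p.1.1 p.1.2 p.2 t y)|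
    <= A * (`|h - k| + `|k| * `|x - y|).
  apply: finite_bound => [p a b ab H t x y h k tT|[[i l] q]].
    by rewrite /= (le_trans (H _ _ _ _ _ tT))// ler_wpM2r//; nonneg.
  by have [C _ H] := smooth_four_point (faS i l q); exists C.
pose A := A1 + A2 + A3 + A4 + A5 + A6.
have [? ? ? ? [? ?]] : [/\ A1 <= A, A2 <= A, A3 <= A, A4 <= A & A5 <= A /\ A6 <= A].
  by rewrite /A; split; [lra..|split; lra].
exists A, ds; split; first by rewrite /A; nonneg.
  split.
  - by move=> i l; apply: first_order_boundsW (HA1 (i, l)).
  - by move=> i l j; apply: first_order_boundsW (HA2 (i, l, j)).
  - by move=> i l q; apply: first_order_boundsW (HA3 (i, l, q)).
  - move=> i l t x h tT; by rewrite (le_trans (HA4 (i, l) _ _ _ tT))// ler_wpM2r// exprn_ge0.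
  - move=> i l t x y h k tT; rewrite (le_trans (HA5 (i, l) _ _ _ _ _ tT))//.
    by rewrite ler_wpM2r//; nonneg.
  - move=> i l q t x y h k tT; rewrite (le_trans (HA6 (i, l, q) _ _ _ _ _ tT))//.
    by rewrite ler_wpM2r//; nonneg.
by move=> i l j t x tT; have [_ _ ->] := dsgP (i, l).
Qed.

End CoefficientBounds.

Section IntegralsOnIntervals.
Context (R : realType).
Implicit Types (f g : R -> R) (s u v M c : R).
Local Notation mu := (@lebesgue_measure R).

Lemma lebesgue_measure_oc u v : u <= v -> mu `]u, v]%classic = (v - u)%:E.
Proof.
rewrite lebesgue_measure_itv/= lte_fin le_eqVlt => /predU1P[->|uv].
  by rewrite ltxx subrr.
by rewrite uv EFinB.
Qed.

Lemma lebesgue_measure_cc u v : u <= v -> mu `[u, v]%classic = (v - u)%:E.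
Proof.
rewrite lebesgue_measure_itv/= lte_fin le_eqVlt => /predU1P[->|uv].
  by rewrite ltxx subrr.
by rewrite uv EFinB.
Qed.

Lemma bounded_Rintegral_split f s u v M : s <= u -> u <= v ->
  (forall r, s <= r -> r <= v -> `|f r| <= M) ->
  \int[mu]_(r in `[s, v]) f r =
  \int[mu]_(r in `[s, u]) f r + \int[mu]_(r in `]u, v]) f r.
Proof.
move=> su uv fM.
have -> : `[s, v]%classic = `[s, u]%classic `|` `]u, v]%classic.
  by rewrite -itv_bndbnd_setU// bnd_simp.
apply: (@bounded_Rintegral_setU _ _ _ _ _ _ _ M) => //.
- by rewrite [ltLHS](lebesgue_measure_cc su) ltry.
- by rewrite [ltLHS](lebesgue_measure_oc uv) ltry.
- rewrite disj_set2E; apply/eqP/seteqP; split => // r [/=].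
  by rewrite !in_itv/= => /andP[_ ru] /andP[/lt_le_trans/(_ ru)]; rewrite ltxx.
- move=> r [] /=; rewrite in_itv/= => /andP[r1 r2]; apply: fM => //.
  + exact: le_trans uv.
  + by rewrite (le_trans su)// ltW.
Qed.

Lemma ler_norm_Rintegral_oc f u v M : u <= v -> 0 <= M ->
  (forall r, u <= r -> r <= v -> `|f r| <= M) ->
  `|\int[mu]_(r in `]u, v]) f r| <= 2 * M * (v - u).
Proof.
move=> uv M0 fM; have mE := lebesgue_measure_oc uv.
have fin : (mu `]u, v]%classic < +oo)%E by rewrite mE ltry.
have -> : v - u = fine (mu `]u, v]%classic) by rewrite mE.
apply: (ler_norm_Rintegral _ fin) => // r /=; rewrite in_itv/= => /andP[/ltW ur rv].
exact: fM.
Qed.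

Lemma ler_dist_Rintegral_oc f g u v M c : u <= v -> 0 <= c ->
  (forall r, u <= r -> r <= v -> `|f r| <= M) ->
  (forall r, u <= r -> r <= v -> `|g r| <= M) ->
  (forall r, u <= r -> r <= v -> `|f r - g r| <= c) ->
  `|\int[mu]_(r in `]u, v]) f r - \int[mu]_(r in `]u, v]) g r| <= 2 * c * (v - u).
Proof.
move=> uv c0 fM gM fg; have mE := lebesgue_measure_oc uv.
have fin : (mu `]u, v]%classic < +oo)%E by rewrite mE ltry.
have -> : v - u = fine (mu `]u, v]%classic) by rewrite mE.
by apply: (ler_dist_Rintegral (M := M) _ fin) => // r /=;
  rewrite in_itv/= => /andP[/ltW ur rv]; [exact: fM|exact: gM|exact: fg].
Qed.

End IntegralsOnIntervals.

Section Drift.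
Context (R : realType) (m k : nat) (T : R) (U : set 'rV[R]_k) (a0 : U).
Variables (d : U -> U -> R) (b : R -> 'rV[R]_m -> 'rV[R]_k -> 'rV[R]_m).
Variables (Mb Lb : R).
Hypotheses (Mb0 : 0 <= Mb) (Lb0 : 0 <= Lb).
Hypothesis bM : forall t x (a : U) i, 0 <= t <= T -> `|b t x (\val a) 0 i| <= Mb.
Hypothesis bL : forall t x y (a : U) i, 0 <= t <= T ->
  `|b t x (\val a) 0 i - b t y (\val a) 0 i| <= Lb * `|x - y|.
Implicit Types (gamma : R -> P2 a0 d) (x y : R -> 'rV[R]_m).

Definition mean_drift gamma x (i : 'I_m) (r : R) : R :=
  \int[gamma r]_(a in [set: control a0 d]) b r (x r) (\val (a : U)) 0 i.

Lemma mean_drift_le gamma x i r : 0 <= r <= T -> `|mean_drift gamma x i r| <= 2 * Mb.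
Proof.
move=> rT; have mass : P2_prob (gamma r) [set: control a0 d] = 1%:E.
  exact: probability_setT.
have fin : (P2_prob (gamma r) [set: control a0 d] < +oo)%E by rewrite mass ltry.
have -> : 2 * Mb = 2 * Mb * fine (P2_prob (gamma r) [set: control a0 d]).
  by rewrite mass mulr1.
by apply: (ler_norm_Rintegral _ fin) => // a _; exact: bM.
Qed.

Lemma mean_drift_dist gamma x y i r : 0 <= r <= T ->
  `|mean_drift gamma x i r - mean_drift gamma y i r| <= 2 * (Lb * `|x r - y r|).
Proof.
move=> rT; have mass : P2_prob (gamma r) [set: control a0 d] = 1%:E.
  exact: probability_setT.
have fin : (P2_prob (gamma r) [set: control a0 d] < +oo)%E by rewrite mass ltry.
have -> : 2 * (Lb * `|x r - y r|) =
    2 * (Lb * `|x r - y r|) * fine (P2_prob (gamma r) [set: control a0 d]).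
  by rewrite mass mulr1.
apply: (ler_dist_Rintegral (M := Mb) _ fin) => //.
- exact: mulr_ge0.
- by move=> a _; exact: bM.
- by move=> a _; exact: bM.
- by move=> a _; exact: bL.
Qed.

Lemma drift_increment gamma x i s u v : 0 <= s -> s <= u -> u <= v -> v <= T ->
  (drift b gamma x s v - drift b gamma x s u) 0 i =
  \int[lebesgue_measure]_(r in `]u, v]) mean_drift gamma x i r.
Proof.
move=> s0 su uv vT; rewrite !mxE -/(mean_drift gamma x i).
rewrite (@bounded_Rintegral_split R (mean_drift gamma x i) s u v (2 * Mb)) //.
  by rewrite addrAC subrr add0r.
by move=> r sr rv; apply: mean_drift_le; rewrite (le_trans s0 sr) (le_trans rv vT).
Qed.

Lemma drift_drift_bounded gamma x s : 0 <= s ->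
  drift_bounded T (2 * (2 * Mb)) s (drift b gamma x s).
Proof.
move=> s0 i u v su uv vT; rewrite drift_increment//.
apply: ler_norm_Rintegral_oc => //; first exact: mulr_ge0.
move=> r ur rv; apply: mean_drift_le.
by rewrite (le_trans s0 (le_trans su ur)) (le_trans rv vT).
Qed.

(** The drifts may start from different times, since only the
    increments after s2, where the two controls agree, are compared. *)
Lemma drift_drift_lipschitz gamma gamma' x y s1 s2 : 0 <= s1 -> s1 <= s2 ->
  (forall r, s2 <= r -> r <= T -> gamma r = gamma' r) ->
  drift_lipschitz T (4 * Lb) s2 x y (drift b gamma x s1) (drift b gamma' y s2).
Proof.
move=> s10 s12 gg i u v e su uv vT e0 xye.
have s20 := le_trans s10 s12.
have rT r : u <= r -> r <= v -> 0 <= r <= T.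
  by move=> ur rv; rewrite (le_trans s20 (le_trans su ur)) (le_trans rv vT).
have subE (p q : 'rV[R]_m) : (p - q) 0 i = p 0 i - q 0 i by rewrite !mxE.
rewrite subE !drift_increment//; last exact: le_trans su.
rewrite (_ : 4 * Lb * e * _ = 2 * (2 * (Lb * e)) * (v - u)); last by ring.
apply: (@ler_dist_Rintegral_oc _ _ _ _ _ (2 * Mb)) => //.
- by rewrite !mulr_ge0.
- by move=> r ur rv; apply: mean_drift_le; exact: rT.
- by move=> r ur rv; apply: mean_drift_le; exact: rT.
- move=> r ur rv.
  have -> : mean_drift gamma' y i r = mean_drift gamma y i r.
    by rewrite /mean_drift gg// ?(le_trans su)// (le_trans rv).
  rewrite (le_trans (mean_drift_dist _ _ _ _ (rT _ ur rv)))//.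
  by rewrite ler_wpM2l// ler_wpM2l// xye.
Qed.

End Drift.

Section DriftBounds.
Context (R : realType) (m k : nat) (T : R) (U : set 'rV[R]_k).

Lemma is_derive_coord (f : 'rV[R]_m -> 'rV[R]_m) x v (l : 'rV[R]_m) i :
  is_derive x v f l -> is_derive x v (fun z => f z 0 i) (l 0 i).
Proof.
move=> [df <-]; split; first by have [H _] := derivable_mxP f x v; exact: H.
by rewrite derive_mx// mxE.
Qed.

Lemma Cb011_bounds (b : R -> 'rV[R]_m -> 'rV[R]_k -> 'rV[R]_m) : Cb011 T U b ->
  exists M L, [/\ 0 <= M, 0 <= L,
    forall t x (a : U) i, 0 <= t <= T -> `|b t x (\val a) 0 i| <= M &
    forall t x y (a : U) i, 0 <= t <= T ->
      `|b t x (\val a) 0 i - b t y (\val a) 0 i| <= L * `|x - y|].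
Proof.
move=> [bx [ba [[_ [M bM]] bxP bxC _ _]]].
have Ua (a : U) : U (\val a) by exact: set_mem (valP a).
have [N N0 bxN] : exists2 N, 0 <= N & forall j t x a, 0 <= t <= T -> U a ->
    `|bx j t x a| <= N.
  apply: finite_bound => [j p q pq H t x a tT aU|j].
    by rewrite (le_trans (H _ _ _ tT aU)).
  have [_ [N H]] := bxC j; exists N => t x a tT aU.
  by apply: (H (t, x, a)); split.
exists `|M|, (m%:R * N); split => //; first exact: mulr_ge0.
- move=> t x a i tT; rewrite (le_trans (ler_norm_coord _ _))//.
  rewrite (le_trans _ (ler_norm M))//.
  by apply: (bM (t, x, \val a)); split => //=; exact: Ua.
- move=> t x y a i tT.
  apply: (@mean_value_lipschitz _ _ (fun z => b t z (\val a) 0 i)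
    (fun j z => bx j t z (\val a) 0 i)) => j z.
    by apply: is_derive_coord; apply: bxP => //; exact: Ua.
  by rewrite (le_trans (ler_norm_coord _ _))// bxN.
Qed.

End DriftBounds.

(** * Solutions driven by a geometric rough path *)

Section FromRoughPaths.
Context (R : realType) (n : nat) (T alpha beta : R).
Variables (zeta : R -> 'rV[R]_n) (zeta2 : R -> R -> 'M[R]_n).
Hypotheses (hbeta : 3^-1 < beta <= 2^-1) (balpha : beta <= alpha).
Hypothesis hzeta : geometric_rough_path zeta zeta2 alpha T.

Let beta0 : 0 < beta.
Proof. by case/andP: hbeta => + _; apply: lt_trans; rewrite invr_gt0. Qed.

Lemma holder_weight_sqr u v : holder_weight beta u v ^+ 2 = (v - u) `^ (2 * beta).
Proof.
by rewrite -powR_mulrn ?holder_weight_ge0// /holder_weight -powRrM mulrC.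
Qed.

Lemma geometric_rough_path_bounds : exists2 Z, 0 <= Z &
  forall u v, 0 <= u -> u <= v -> v <= T ->
  (forall l, `|(zeta v - zeta u) 0 l| <= Z * (v - u) `^ alpha) /\
  (forall q l, `|zeta2 u v q l| <= Z * (v - u) `^ (2 * alpha)).
Proof.
have [[C1 H1] _ [_ _ [C2 H2]] _ _] := hzeta.
exists (`|C1| + `|C2|); first exact: addr_ge0.
move=> u v u0 uv vT; have vu : 0 <= v - u by rewrite subr_ge0.
split=> [l|q l].
  rewrite (le_trans (ler_norm_coord _ _))// (le_trans (H1 u v _ _))//.
  - by rewrite u0 (le_trans uv).
  - by rewrite vT (le_trans u0).
  - rewrite ger0_norm// ler_wpM2r ?powR_ge0// (le_trans (ler_norm _))//.
    by rewrite lerDl.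
rewrite (le_trans (ler_norm_entry _ _ _))// (le_trans (H2 u v _ _))//.
  by rewrite u0.
rewrite ger0_norm// ler_wpM2r ?powR_ge0// (le_trans (ler_norm _))//.
by rewrite lerDr.
Qed.

Lemma geometric_rough_driver : exists2 Z, 0 <= Z & rough_driver T beta Z zeta zeta2.
Proof.
have [Z Z0 HZ] := geometric_rough_path_bounds.
have [_ _ _ chen _] := hzeta.
pose T1 := T `^ (alpha - beta); pose T2 := T `^ (2 * alpha - 2 * beta).
have T10 : 0 <= T1 by exact: powR_ge0.
have T20 : 0 <= T2 by exact: powR_ge0.
exists (Z * (T1 + T2)); first by rewrite mulr_ge0// addr_ge0.
have vuT u v : 0 <= u -> u <= v -> v <= T -> 0 <= v - u /\ v - u <= T.
  by move=> *; split; lra.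
split.
- move=> u v l u0 uv vT; have [vu0 vu] := vuT u v u0 uv vT.
  rewrite (le_trans ((HZ u v u0 uv vT).1 l))// -mulrA ler_wpM2l//.
  rewrite (le_trans (powR_le_exponent vu0 vu beta0 balpha))//.
  by rewrite ler_wpM2r ?powR_ge0// lerDl.
- move=> u v q l u0 uv vT; have [vu0 vu] := vuT u v u0 uv vT.
  rewrite (le_trans ((HZ u v u0 uv vT).2 q l))// -mulrA ler_wpM2l//.
  rewrite (le_trans (powR_le_exponent vu0 vu (p := 2 * beta) _ _)) ?mulr_gt0//.
    by rewrite ler_wpM2l.
  by rewrite holder_weight_sqr ler_wpM2r ?powR_ge0// lerDr.
- move=> u w v q l u0 uw wv vT.
  by rewrite -(chen u w v q l) ?u0 ?uw ?wv ?vT//; ring.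
Qed.

End FromRoughPaths.

Section FromRoughSolutions.
Context (R : realType) (m n k : nat) (T alpha beta kappa : R).
Variables (zeta : R -> 'rV[R]_n) (zeta2 : R -> R -> 'M[R]_n).
Hypotheses (hbeta : 3^-1 < beta <= 2^-1) (bkappa : beta <= kappa).
Hypothesis hzeta : geometric_rough_path zeta zeta2 alpha T.
Context (U : set 'rV[R]_k) (a0 : U) (d : U -> U -> R).
Variables (b : R -> 'rV[R]_m -> 'rV[R]_k -> 'rV[R]_m).
Variables (sigma : R -> 'rV[R]_m -> 'M[R]_(m, n)).
Variable dsg : 'I_m -> 'I_n -> 'I_m -> R -> 'rV[R]_m -> R.
Hypothesis dsgE : forall i l j t x, 0 <= t <= T ->
  'D_(delta_mx 0 j) (fun z => sigma t z i l) x = dsg i l j t x.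
Variables (s : R) (y : 'rV[R]_m) (gamma : R -> P2 a0 d) (x : R -> 'rV[R]_m).
Hypothesis sT : 0 <= s <= T.
Hypothesis xsol : rough_solution zeta zeta2 b sigma kappa T s y gamma x.

Let sg i l t x := sigma t x i l.

Lemma rough_solution_initial : x s = y.
Proof.
have [x' [_ _ xint]] := xsol; apply/rowP => i.
have ss : s <= s <= T by rewrite lexx; case/andP: sT.
have drift0 : drift b gamma x s s 0 i = 0.
  by rewrite mxE set_itv1 Rintegral_set1.
have := xint s i ss; rewrite drift0 subr0 => I0.
apply/eqP; rewrite -subr_eq0 -normr_le0; apply/ler_addgt0Pr => e e0.
have [dl dl0 H] := I0 e e0.
(* The empty sequence is the partition of [s, s], and its sum is 0. *)
have := H [::]; rewrite /rough_sum big_geq// sub0r normrN add0r.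
move=> /(_ _ _)/ltW; apply; last by [].
by split => //=.
Qed.

(** The rough integrals from s being the increments of x minus
    its drift, [dyadic_sum_rough_integral] says that the dyadic sums of
    [euler_rem] tend to 0. *)
Lemma rough_solution_davie :
  davie_solution T beta zeta zeta2 sg dsg s x (drift b gamma x s).
Proof.
have /andP[s0 sT'] := sT.
have beta0 : 0 < beta.
  by case/andP: hbeta => + _; apply: lt_trans; rewrite invr_gt0.
have [x' [[_ _ [_ _ [C HC]]] x'E xint]] := xsol.
have [_ _ [_ z2diag _] _ _] := hzeta.
split.
- exists (`|C| * T `^ (2 * kappa - 2 * beta)); first by rewrite mulr_ge0// powR_ge0.
  move=> u v su uv vT.
  have uT : s <= u <= T by rewrite su (le_trans uv).
  have -> : controlled_rem zeta sg x u v = x v - x u - (zeta v - zeta u) *m (x' u)^T.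
    rewrite /controlled_rem; congr (_ - _); apply/rowP => i; rewrite !mxE.
    by apply: eq_bigr => l _; rewrite [_^T _ _]mxE x'E// mulrC.
  have suv : s <= u <= v by rewrite su.
  rewrite (le_trans (HC u v suv vT))// ger0_norm ?subr_ge0//.
  have vu0 : 0 <= v - u by rewrite subr_ge0.
  have vuT : v - u <= T by lra.
  apply: (@le_trans _ _ (`|C| * (v - u) `^ (2 * kappa))).
    by rewrite ler_wpM2r ?powR_ge0// ler_norm.
  rewrite -mulrA ler_wpM2l// holder_weight_sqr.
  by apply: powR_le_exponent => //; [exact: mulr_gt0|rewrite ler_wpM2l].
- move=> i u v su uv vT e e0.
  pose mu r : 'rV[R]_n := \row_l sigma r (x r) i l.
  pose mu' r : 'M[R]_n := \matrix_(l, q) \sum_(j < m)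
    'D_(delta_mx 0 j) (fun z => sigma r z i l) (x r) * x' r j q.
  pose I t := x t 0 i - y 0 i - drift b gamma x s t 0 i.
  have zd r : s <= r <= T -> zeta2 r r = 0.
    by move=> /andP[sr rT]; apply: z2diag; rewrite (le_trans s0).
  have [N HN] := dyadic_sum_rough_integral (mu := mu) (mu' := mu') (I := I) zd
    (fun t tT => xint t i tT) su uv vT e0.
  exists N => p Np; rewrite -normrN; have := HN p Np.
  rewrite -(dyadic_sum_increment I p) -dyadic_sumB.
  rewrite (@eq_dyadic_sum _ _ (fun a c => 0 - euler_rem zeta zeta2 sg dsg x
    (drift b gamma x s) i a c) p u v uv).
    rewrite dyadic_sumB; have -> : dyadic_sum p (fun _ _ => 0) u v = 0 :> R.
      have := dyadic_sum_increment (fun=> 0) p u v; rewrite subrr => {2}<-.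
      by apply: eq_dyadic_sum => // *; rewrite subrr.
    by rewrite sub0r.
  move=> a c ua ac cv.
  have aT : s <= a <= T by rewrite (le_trans su ua) (le_trans ac (le_trans cv vT)).
  have aT' : 0 <= a <= T by case/andP: aT => sa ->; rewrite (le_trans s0 sa).
  rewrite /compensated_term /euler_rem /I.
  have -> : \sum_i0 mu a 0 i0 * (zeta c - zeta a) 0 i0 = first_order zeta sg x a c 0 i.
    by rewrite mxE; apply: eq_bigr => l _; rewrite mxE.
  have -> : \sum_i0 \sum_j mu' a i0 j * zeta2 a c j i0 =
      second_order zeta2 sg dsg x i a c.
    apply: eq_bigr => l _; apply: eq_bigr => q _; congr (_ * _).
    rewrite mxE; apply: eq_bigr => j _.
    by rewrite dsgE// x'E.
  have -> : (x c - x a) 0 i = x c 0 i - x a 0 i by rewrite !mxE.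
  have -> : (drift b gamma x s c - drift b gamma x s a) 0 i =
    drift b gamma x s c 0 i - drift b gamma x s a 0 i.
    by move: (drift b gamma x s c) (drift b gamma x s a) => p1 p2; rewrite !mxE.
  ring.
Qed.

End FromRoughSolutions.

(** * Controls, payoffs and the value function *)

(** Elements at distance at most c being found in both directions, A
    and B are both empty or both nonempty; when both are empty, both suprema are
    0 by convention. *)
Lemma sup_dist_le (R : realType) (A B : set R) (c M : R) : 0 <= c ->
  (forall a, A a -> `|a| <= M) -> (forall a, B a -> `|a| <= M) ->
  (forall a, A a -> exists2 a', B a' & `|a - a'| <= c) ->
  (forall a', B a' -> exists2 a, A a & `|a - a'| <= c) ->
  `|sup A - sup B| <= c.
Proof.
move=> c0 AM BM AB BA.
have half (A' B' : set R) : (forall a, B' a -> `|a| <= M) ->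
    (forall a, A' a -> exists2 a', B' a' & `|a - a'| <= c) -> A' !=set0 ->
    sup A' <= sup B' + c.
  move=> B'M A'B' A'0; apply: sup_le_ub => // a /A'B' [a' Ba' aa'].
  have : a' <= sup B'.
    by apply: ub_le_sup => //; exists M => z /B'M; apply: le_trans (ler_norm _).
  by move: aa'; rewrite ler_norml => /andP[? ?]; lra.
have [A0|/set0P[a Aa]] := eqVneq A set0.
  have [B0|/set0P[a' Ba']] := eqVneq B set0; first by rewrite A0 B0 subrr normr0.
  by have [a Aa _] := BA _ Ba'; rewrite A0 in Aa.
have [a' Ba' _] := AB _ Aa.
have H1 := half A B BM AB (ex_intro _ a Aa).
have BA' z : B z -> exists2 z', A z' & `|z - z'| <= c.
  by move=> /BA [z' ? ?]; exists z' => //; rewrite distrC.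
have H2 := half B A AM BA' (ex_intro _ a' Ba').
by rewrite ler_norml; apply/andP; split; lra.
Qed.

Section Controls.
Context (R : realType) (k : nat) (U : set 'rV[R]_k) (a0 : U) (d : U -> U -> R).
Variables (K : set (P2 a0 d)) (eps L T : R).
Hypotheses (eps0 : 0 < eps) (L0 : 0 <= L).
Implicit Types (gamma : R -> P2 a0 d) (s : R).

Lemma admissible_restrict s1 s2 gamma : s1 <= s2 ->
  admissible K eps L s1 T gamma -> admissible K eps L s2 T gamma.
Proof.
move=> s12 [gK gL]; split=> [r /andP[sr rT]|r t /andP[sr rT] /andP[st tT]].
  by apply: gK; rewrite (le_trans s12).
by apply: gL; rewrite (le_trans s12).
Qed.

Definition freeze_before s gamma (r : R) : P2 a0 d := if r < s then gamma s else gamma r.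

(** Freezing never increases distances in time.  At two times
    before s the bound needed is that of the pair (s, s), which makes W2 vanish
    there. *)
Lemma admissible_freeze s1 s2 gamma : s2 <= T ->
  admissible K eps L s2 T gamma -> admissible K eps L s1 T (freeze_before s2 gamma).
Proof.
move=> s2T [gK gL]; have s22 : s2 <= s2 <= T by rewrite lexx.
split=> [r /andP[_ rT]|r t /andP[_ rT] /andP[_ tT]]; rewrite /freeze_before.
  by case: ltP => [_|rs]; apply: gK; rewrite ?lexx ?rs.
have mono (p q : R) : 0 <= p -> p <= q ->
    ((L * p `^ eps)%:E <= (L * q `^ eps)%:E)%E.
  move=> p0 pq; rewrite lee_fin ler_wpM2l// ge0_ler_powR ?nnegrE//.
  - exact: ltW.
  - exact: le_trans pq.
case: ltP => rs; case: ltP => ts.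
- by apply: le_trans (gL s2 s2 s22 s22) (mono _ _ _ _); rewrite subrr normr0.
- apply: le_trans (gL s2 t s22 _) (mono _ _ _ _) => //; first by rewrite ts.
  by rewrite !ger0_norm ?subr_ge0//; lra.
- apply: le_trans (gL r s2 _ s22) (mono _ _ _ _) => //; first by rewrite rs.
  by rewrite distrC (distrC t) !ger0_norm ?subr_ge0//; lra.
- by apply: gL; rewrite ?rs ?ts.
Qed.

End Controls.

Section Payoff.
Context (R : realType) (m k : nat) (U : set 'rV[R]_k) (a0 : U) (d : U -> U -> R).
Variables (K : set (P2 a0 d)) (T MF LF MG LG : R).
Variables (F : R -> 'rV[R]_m -> P2 a0 d -> R) (G : 'rV[R]_m -> R).
Hypotheses (MF0 : 0 <= MF) (LF0 : 0 <= LF) (LG0 : 0 <= LG).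
Hypothesis FM : forall t x g, 0 <= t <= T -> K g -> `|F t x g| <= MF.
Hypothesis FL : forall t x x' g, 0 <= t <= T -> K g ->
  `|F t x' g - F t x g| <= LF * `|x' - x|.
Hypothesis GM : forall x, `|G x| <= MG.
Hypothesis GL : forall x x', `|G x' - G x| <= LG * `|x' - x|.
Implicit Types (gamma : R -> P2 a0 d) (x : R -> 'rV[R]_m) (s : R).

Definition payoff s gamma x : R :=
  \int[lebesgue_measure]_(r in `[s, T]) F r (x r) (gamma r) + G (x T).

Lemma payoff_le s gamma x : 0 <= s <= T ->
  (forall r, s <= r <= T -> K (gamma r)) ->
  `|payoff s gamma x| <= 2 * MF * T + MG.
Proof.
move=> /andP[s0 sT] gK; rewrite (le_trans (ler_normD _ _))// lerD//.
have mE := lebesgue_measure_cc sT.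
have fin : (lebesgue_measure `[s, T]%classic < +oo)%E by rewrite mE ltry.
apply: (@le_trans _ _ (2 * MF * fine (lebesgue_measure `[s, T]%classic))).
  apply: (ler_norm_Rintegral _ fin) => // r /=; rewrite in_itv/= => /andP[sr rT].
  by apply: FM; rewrite ?(le_trans s0) ?rT//; apply: gK; rewrite sr.
by rewrite mE ler_wpM2l ?mulr_ge0//=; lra.
Qed.

Lemma payoff_dist s1 s2 gamma1 gamma2 x1 x2 (e : R) :
  0 <= s1 -> s1 <= s2 -> s2 <= T -> 0 <= e ->
  (forall r, s1 <= r <= T -> K (gamma1 r)) ->
  (forall r, s2 <= r -> r <= T -> gamma1 r = gamma2 r) ->
  (forall r, s2 <= r -> r <= T -> `|x1 r - x2 r| <= e) ->
  `|payoff s1 gamma1 x1 - payoff s2 gamma2 x2|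
  <= 2 * MF * (s2 - s1) + (2 * LF * T + LG) * e.
Proof.
move=> s10 s12 s2T e0 gK gg xe; have s20 := le_trans s10 s12.
pose f1 r := F r (x1 r) (gamma1 r); pose f2 r := F r (x2 r) (gamma2 r).
have f1M r : s1 <= r -> r <= T -> `|f1 r| <= MF.
  by move=> sr rT; apply: FM; rewrite ?(le_trans s10)//; apply: gK; rewrite sr.
have f2M r : s2 <= r -> r <= T -> `|f2 r| <= MF.
  move=> sr rT; apply: FM; first by rewrite (le_trans s20).
  by rewrite -gg//; apply: gK; rewrite (le_trans s12).
rewrite /payoff -/(f1 _) -/(f2 _).
have -> : \int[lebesgue_measure]_(r in `[s1, T]) F r (x1 r) (gamma1 r) =
   \int[lebesgue_measure]_(r in `[s1, s2]) f1 r +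
   \int[lebesgue_measure]_(r in `]s2, T]) f1 r.
  exact: (bounded_Rintegral_split (M := MF)).
have -> : \int[lebesgue_measure]_(r in `[s2, T]) F r (x2 r) (gamma2 r) =
   \int[lebesgue_measure]_(r in `]s2, T]) f2 r.
  have := bounded_Rintegral_split (lexx s2) s2T f2M.
  by rewrite set_itv1 Rintegral_set1 add0r.
have L1 : `|\int[lebesgue_measure]_(r in `[s1, s2]) f1 r| <= 2 * MF * (s2 - s1).
  have mE := lebesgue_measure_cc s12.
  have fin : (lebesgue_measure `[s1, s2]%classic < +oo)%E by rewrite mE ltry.
  have -> : s2 - s1 = fine (lebesgue_measure `[s1, s2]%classic) by rewrite mE.
  apply: (ler_norm_Rintegral _ fin) => // r /=; rewrite in_itv/= => /andP[sr rs].
  by apply: f1M => //; exact: le_trans s2T.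
have L2 : `|\int[lebesgue_measure]_(r in `]s2, T]) f1 r -
    \int[lebesgue_measure]_(r in `]s2, T]) f2 r| <= 2 * (LF * e) * (T - s2).
  apply: (ler_dist_Rintegral_oc (M := MF)) => //.
  - exact: mulr_ge0.
  - by move=> r sr rT; apply: f1M => //; exact: le_trans sr.
  - move=> r sr rT; rewrite /f2 -gg// /f1.
    rewrite (le_trans (FL _ _ _ _))//; first by rewrite (le_trans s20).
      by apply: gK; rewrite (le_trans s12).
    by rewrite ler_wpM2l// xe.
have L3 : `|G (x1 T) - G (x2 T)| <= LG * e.
  by rewrite (le_trans (GL _ _))// ler_wpM2l// xe.
have L4 : 2 * (LF * e) * (T - s2) <= 2 * LF * T * e.
  rewrite (_ : 2 * LF * T * e = 2 * (LF * e) * T); last by ring.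
  by rewrite ler_wpM2l ?mulr_ge0//; lra.
rewrite (_ : _ - _ = \int[lebesgue_measure]_(r in `[s1, s2]) f1 r +
  (\int[lebesgue_measure]_(r in `]s2, T]) f1 r -
    \int[lebesgue_measure]_(r in `]s2, T]) f2 r) + (G (x1 T) - G (x2 T))); last by ring.
apply: (le_trans (ler_normD _ _)).
apply: (le_trans (lerD (ler_normD _ _) (lexx _))).
rewrite [leRHS](_ : _ = 2 * MF * (s2 - s1) + 2 * LF * T * e + LG * e); last by ring.
apply: lerD L3; apply: lerD L1 _; exact: le_trans L2 L4.
Qed.

End Payoff.

Unset Implicit Arguments.

Theorem proposition4p8 (R : realType) (m n k : nat) (T alpha kappa : R)
    (hT : 0 < T) (halpha : 3^-1 < alpha < 1) (hkappa : 3^-1 < kappa < alpha)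
    (zeta : R -> 'rV[R]_n) (zeta2 : R -> R -> 'M[R]_n)
    (hzeta : geometric_rough_path zeta zeta2 alpha T)
    (U : set 'rV[R]_k) (a0 : U) (d : U -> U -> R) (hd : is_metric d)
    (K : set (P2 a0 d)) (hK : compact K)
    (eps L : R) (heps : 0 < eps) (hL : 0 < L)
    (b : R -> 'rV[R]_m -> 'rV[R]_k -> 'rV[R]_m)
    (hb : Cb011 T U b)
    (hb_lip : exists C : R, forall t x (a a' : U), 0 <= t <= T ->
       `|b t x (\val a') - b t x (\val a)| <= C * d a a')
    (hb_unif : forall (x : 'rV[R]_m) (e : R), 0 < e ->
       exists2 delta : R, 0 < delta &
         forall u1 u2, 0 <= u1 <= T -> 0 <= u2 <= T -> `|u2 - u1| < delta ->
           forall a, U a -> `|b u2 x a - b u1 x a| <= e)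
    (sigma : R -> 'rV[R]_m -> 'M[R]_(m, n))
    (hsigma : forall i j, Cb 1 3 T (fun t x => sigma t x i j))
    (F : R -> 'rV[R]_m -> P2 a0 d -> R)
    (hF_meas : forall x g, K g -> measurable_fun `[0, T] (fun t => F t x g))
    (hF_bdd : exists M : R, forall t x g, 0 <= t <= T -> K g ->
       `|F t x g| <= M)
    (hF_lipx : exists C : R, forall t x x' g, 0 <= t <= T -> K g ->
       `|F t x' g - F t x g| <= C * `|x' - x|)
    (hF_lipg : forall x, exists2 C : R, 0 <= C &
       forall t g g', 0 <= t <= T -> K g -> K g' ->
         (`|F t x g' - F t x g|%:E <= C%:E * W2 g g')%E)
    (G : 'rV[R]_m -> R)
    (hG_bdd : exists M : R, forall x, `|G x| <= M)
    (hG_cont : continuous G)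
    (hG_lip : exists C : R, forall x x', `|G x' - G x| <= C * `|x' - x|)
    (X : R -> 'rV[R]_m -> (R -> P2 a0 d) -> R -> 'rV[R]_m)
    (hX : forall s y gamma, 0 <= s <= T -> admissible K eps L s T gamma ->
       rough_solution zeta zeta2 b sigma kappa T s y gamma (X s y gamma)) :
  exists C : R, forall (s1 s2 : R) (y1 y2 : 'rV[R]_m),
    0 <= s1 <= T -> 0 <= s2 <= T ->
    `|value F G X K eps L T s2 y2 - value F G X K eps L T s1 y1|
    <= C * (`|y1 - y2| + (1 + `|y1| + `|y2|) * `|s1 - s2| `^ alpha).
Proof.
have /andP[a3 a1] := halpha; have /andP[k3 ka] := hkappa.
(* 1/3 < beta gives 3 beta > 1; beta <= 1/2 lets tau^2 dominate the drift. *)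
pose beta := Num.min kappa 2^-1.
have hbeta : 3^-1 < beta <= 2^-1.
  by rewrite /beta lt_min k3 ge_min lexx orbT andbT/= ltf_pV2 ?posrE// ltr_nat.
have bk : beta <= kappa by rewrite /beta ge_min lexx.
have ba : beta <= alpha by rewrite (le_trans bk)// ltW.
have alpha0 : 0 < alpha by rewrite (lt_trans _ a3)// invr_gt0.
have [Z Z0 hz] := geometric_rough_driver hbeta ba hzeta.
have [Za Za0 hza] := geometric_rough_path_bounds hzeta.
have [A [dsg [A0 hs dsgE]]] := Cb_field_bounds hsigma.
have [Mb [Lb [Mb0 Lb0 bM bL]]] := Cb011_bounds hb.
have M0 : 0 <= 2 * (2 * Mb) by rewrite !mulr_ge0.
have M10 : 0 <= 4 * Lb by rewrite mulr_ge0.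
have [h [C [h0 h1 C0 stab incr]]] := rough_equation_estimates hbeta Z0 A0 M0 M10 hz hs.
have [MF hMF] := hF_bdd; have [LF hLF] := hF_lipx.
have [MG hMG] := hG_bdd; have [LG hLG] := hG_lip.
have FM t x g : 0 <= t <= T -> K g -> `|F t x g| <= `|MF|.
  by move=> tT Kg; rewrite (le_trans (hMF _ _ _ tT Kg))// ler_norm.
have FL t x x' g : 0 <= t <= T -> K g -> `|F t x' g - F t x g| <= `|LF| * `|x' - x|.
  by move=> tT Kg; rewrite (le_trans (hLF _ _ _ _ tT Kg))// ler_wpM2r// ler_norm.
have GM x : `|G x| <= `|MG| by rewrite (le_trans (hMG x))// ler_norm.
have GL x x' : `|G x' - G x| <= `|LG| * `|x' - x|.
  by rewrite (le_trans (hLG _ _))// ler_wpM2r// ler_norm.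
have T0 := ltW hT.
pose Vmax := 2 * `|MF| * T + `|MG|.
have Vmax0 : 0 <= Vmax by rewrite addr_ge0// !mulr_ge0.
(* The drift, the driver, its area and the remainder contribute 1, Za, Za, 1. *)
pose Cincr := C * (2 + 2 * Za).
pose Cshort := 2 * `|MF| + (2 * `|LF| * T + `|LG|) * (C * (1 + Cincr)).
have Cincr0 : 0 <= Cincr by rewrite !(mulr_ge0, addr_ge0).
have W0 : 0 <= 2 * `|LF| * T + `|LG| by rewrite addr_ge0// !mulr_ge0.
have Cshort0 : 0 <= Cshort by rewrite !(mulr_ge0, addr_ge0).
(* Short times: the trajectories are compared from s2 on. *)
have short s1 s2 y1 y2 gamma1 gamma2 : 0 <= s1 -> s1 <= s2 -> s2 <= T -> s2 - s1 <= h ->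
    admissible K eps L s1 T gamma1 -> admissible K eps L s2 T gamma2 ->
    (forall r, s2 <= r -> r <= T -> gamma1 r = gamma2 r) ->
    `|payoff T F G s1 gamma1 (X s1 y1 gamma1) - payoff T F G s2 gamma2 (X s2 y2 gamma2)|
    <= Cshort * (`|y1 - y2| + (s2 - s1) `^ alpha).
  move=> s10 s12 s2T sh adm1 adm2 gg.
  have s20 := le_trans s10 s12; have s1T := le_trans s12 s2T.
  have I1 : 0 <= s1 <= T by rewrite s10.
  have I2 : 0 <= s2 <= T by rewrite s20.
  have sol1 := hX s1 y1 gamma1 I1 adm1; have sol2 := hX s2 y2 gamma2 I2 adm2.
  set x1 := X s1 y1 gamma1 in sol1 *; set x2 := X s2 y2 gamma2 in sol2 *.
  have dav1 := rough_solution_davie hbeta bk hzeta dsgE I1 sol1.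
  have dav2 := rough_solution_davie hbeta bk hzeta dsgE I2 sol2.
  have ini1 := rough_solution_initial I1 sol1; have ini2 := rough_solution_initial I2 sol2.
  have bD1 := drift_drift_bounded Mb0 bM gamma1 x1 s10.
  have bD2 := drift_drift_bounded Mb0 bM gamma2 x2 s20.
  have r0 : 0 <= s2 - s1 by rewrite subr_ge0.
  have r1 := le_trans sh h1.
  have ra0 : 0 <= (s2 - s1) `^ alpha by exact: powR_ge0.
  have inc : `|x1 s2 - x1 s1| <= Cincr * (s2 - s1) `^ alpha.
    have [z1 z2] := hza s1 s2 s10 s12 s2T.
    have := incr s1 x1 _ s10 dav1 bD1 s1 s2 _ _ (lexx _) s12 s2T sh z1 z2.
    rewrite !mulr_ge0 ?powR_ge0// => /(_ isT isT) /le_trans; apply.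
    rewrite -mulrA ler_wpM2l//.
    have p1 : s2 - s1 <= (s2 - s1) `^ alpha.
      rewrite -[leLHS](powRr1 r0); apply: powR_le_exponent1 => //; exact: ltW.
    have p2 : (s2 - s1) `^ (2 * alpha) <= (s2 - s1) `^ alpha.
      by apply: powR_le_exponent1 => //; lra.
    (* 3 beta > 1 > alpha, so the remainder is of higher order than alpha. *)
    have p3 : holder_weight beta s1 s2 ^+ 3 <= (s2 - s1) `^ alpha.
      rewrite -powR_mulrn ?holder_weight_ge0// /holder_weight -powRrM.
      apply: powR_le_exponent1 => //.
      by case/andP: hbeta => b3 _; rewrite (le_trans (ltW a1))//; lra.
    have p4 := ler_wpM2l Za0 p2.
    lra.
  have x12 r : s2 <= r -> r <= T ->
      `|x1 r - x2 r| <= C * (`|y1 - y2| + Cincr * (s2 - s1) `^ alpha).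
    move=> sr rT.
    have bD1' : drift_bounded T (2 * (2 * Mb)) s2 (drift b gamma1 x1 s1).
      by move=> i u v su uv vT; apply: bD1 => //; exact: le_trans su.
    have lipD := drift_drift_lipschitz Mb0 Lb0 bM bL (x := x1) (y := x2) s10 s12 gg.
    have := stab s2 x1 x2 _ _ s20 (davie_solution_restrict s12 dav1) dav2 bD1' bD2
      lipD r sr rT.
    move=> /le_trans; apply; rewrite ler_wpM2l// ini2 -ini1.
    rewrite (_ : x1 s2 - y2 = (x1 s1 - y2) + (x1 s2 - x1 s1)); last first.
      by rewrite [RHS]addrC subrKA.
    by rewrite (le_trans (ler_normD _ _))// lerD2l.
  have e0 : 0 <= C * (`|y1 - y2| + Cincr * (s2 - s1) `^ alpha).
    by rewrite mulr_ge0// addr_ge0// mulr_ge0.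
  have [gK1 _] := adm1.
  apply: (le_trans (payoff_dist (normr_ge0 MF) (normr_ge0 LF) (normr_ge0 LG)
    FM FL GL s10 s12 s2T e0 gK1 gg x12)).
  have p1 : s2 - s1 <= (s2 - s1) `^ alpha.
    rewrite -[leLHS](powRr1 r0); apply: powR_le_exponent1 => //; exact: ltW.
  set W := 2 * `|LF| * T + `|LG| in W0 Cshort Cshort0 *.
  set p := (s2 - s1) `^ alpha in ra0 p1 *.
  apply: (le_trans (lerD (ler_wpM2l _ p1) (lexx _))); first by rewrite mulr_ge0.
  rewrite /Cshort [leRHS](_ : _ = 2 * `|MF| * p + W * (C * (`|y1 - y2| + Cincr * p)) +
    (2 * `|MF| * `|y1 - y2| + W * (C * (Cincr * `|y1 - y2| + p)))); last by ring.
  by rewrite lerDl !(addr_ge0, mulr_ge0).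
have val_le s y : 0 <= s <= T -> forall a,
  [set payoff T F G s gamma (X s y gamma) | gamma in admissible K eps L s T] a ->
  `|a| <= Vmax.
  by move=> sT a [gamma [gK _] <-]; exact: (payoff_le (normr_ge0 MF) FM GM _ sT gK).
have valE s y : value F G X K eps L T s y =
  sup [set payoff T F G s gamma (X s y gamma) | gamma in admissible K eps L s T] by [].
(* For s2 - s1 > h the trivial bound 2 Vmax is at most Clong (s2 - s1)^alpha. *)
pose Clong := 2 * Vmax / h `^ alpha.
have Clong0 : 0 <= Clong by rewrite divr_ge0 ?powR_ge0// mulr_ge0.
have ordered s1 s2 y1 y2 : 0 <= s1 -> s1 <= s2 -> s2 <= T ->
    `|value F G X K eps L T s1 y1 - value F G X K eps L T s2 y2|
    <= (Cshort + Clong) * (`|y1 - y2| + (s2 - s1) `^ alpha).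
  move=> s10 s12 s2T; rewrite !valE.
  have s20 := le_trans s10 s12; have s1T := le_trans s12 s2T.
  have I1 : 0 <= s1 <= T by rewrite s10.
  have I2 : 0 <= s2 <= T by rewrite s20.
  have ra0 : 0 <= (s2 - s1) `^ alpha by exact: powR_ge0.
  have [sh|hs12] := leP (s2 - s1) h.
    apply: (@le_trans _ _ (Cshort * (`|y1 - y2| + (s2 - s1) `^ alpha))); last first.
      by rewrite ler_wpM2r ?addr_ge0// lerDl.
    apply: (@sup_dist_le _ _ _ _ Vmax); first by rewrite mulr_ge0// addr_ge0.
    - exact: val_le.
    - exact: val_le.
    - move=> _ [gamma adm <-].
      have adm2 := admissible_restrict s12 adm.
      exists (payoff T F G s2 gamma (X s2 y2 gamma)); first by exists gamma.
      exact: short.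
    - move=> _ [gamma adm <-].
      have adm1 : admissible K eps L s1 T (freeze_before s2 gamma).
        by apply: admissible_freeze => //; exact: ltW.
      exists (payoff T F G s1 (freeze_before s2 gamma) (X s1 y1 (freeze_before s2 gamma))).
        by exists (freeze_before s2 gamma).
      apply: short => // r sr _; rewrite /freeze_before ifF//.
      by apply/negbTE; rewrite -leNgt.
  have V1 := @sup_dist_le _ _ _ (2 * Vmax) Vmax _ (val_le s1 y1 I1) (val_le s2 y2 I2).
  apply: (@le_trans _ _ (2 * Vmax)).
    apply: V1 => [|_ [gamma adm <-]|_ [gamma adm <-]]; first by rewrite mulr_ge0.
    - have adm2 := admissible_restrict s12 adm.
      exists (payoff T F G s2 gamma (X s2 y2 gamma)); first by exists gamma.
      rewrite (le_trans (ler_normB _ _))// mulr_natl mulr2n lerD//.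
        by apply: val_le I1 _ _; exists gamma.
      by apply: val_le I2 _ _; exists gamma.
    - have adm1 : admissible K eps L s1 T (freeze_before s2 gamma).
        by apply: admissible_freeze => //; exact: ltW.
      exists (payoff T F G s1 (freeze_before s2 gamma) (X s1 y1 (freeze_before s2 gamma))).
        by exists (freeze_before s2 gamma).
      rewrite (le_trans (ler_normB _ _))// mulr_natl mulr2n lerD//.
        by apply: val_le I1 _ _; exists (freeze_before s2 gamma).
      by apply: val_le I2 _ _; exists gamma.
  have hp : 0 < h `^ alpha by rewrite powR_gt0.
  have hr : h `^ alpha <= (s2 - s1) `^ alpha.
    by apply: ge0_ler_powR; rewrite ?nnegrE; [exact: ltW..|rewrite subr_ge0|exact: ltW].
  have -> : 2 * Vmax = Clong * h `^ alpha by rewrite /Clong divfK// gt_eqF.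
  apply: (@le_trans _ _ (Clong * (s2 - s1) `^ alpha)); first by rewrite ler_wpM2l.
  by rewrite ler_pM ?lerDr.
exists (Cshort + Clong) => s1 s2 y1 y2 /andP[s10 s1T] /andP[s20 s2T].
have weaken (p : R) : 0 <= p -> (Cshort + Clong) * (`|y1 - y2| + p) <=
    (Cshort + Clong) * (`|y1 - y2| + (1 + `|y1| + `|y2|) * p).
  move=> p0; apply: ler_wpM2l; first exact: addr_ge0.
  rewrite lerD2l ler_peMl//.
  by rewrite -addrA lerDl addr_ge0.
have [s12|/ltW s21] := leP s1 s2.
  rewrite distrC (distrC s1) (ger0_norm (x := s2 - s1)) ?subr_ge0//.
  exact: le_trans (ordered _ _ _ _ s10 s12 s2T) (weaken _ (powR_ge0 _ _)).
rewrite (ger0_norm (x := s1 - s2)) ?subr_ge0//.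
apply: le_trans (weaken _ (powR_ge0 _ _)); rewrite (distrC y1); exact: ordered.
Qed.
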